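(* There exists a system $\mathcal S=\{S_1,S_2,\dots,S_6\}$ of contraction similarities of $\mathbb{R}$ whose attractor $K$ is totally disconnected, satisfies $K\subset[0,1]$ and $\{0,1\}\subset K$, and such that: 1. $\mathcal S$ does not satisfy the open set condition; 2. the only non-empty intersection of distinct pieces $K_i=S_i(K)$, $K_j=S_j(K)$ ($i\neq j$) is $K_3\cap K_4$, and $K_3\cap K_4=\{S_3(0)\}=\{S_4(1)\}$; in particular $\mathcal S$ is post-critically finite; 3. the Hausdorff dimension $\dim_H K$ equals the similarity dimension $s$ of $\mathcal S$, while the $s$-dimensional Hausdorff measure satisfies $H^s(K)=0$.
   Context: For a finite system $\mathcal S=\{S_1,\dots,S_m\}$ of contraction similarities of $\mathbb{R}^n$, the attractor is the unique nonempty compact $K$ with $K=\bigcup_{i=1}^m S_i(K)$; its pieces are $K_i=S_i(K)$. The system satisfies the open set condition (OSC) if there is a nonempty open set $O$ with $S_i(O)\subset O$ for all $i$ and $S_i(O)\cap S_j(O)=\emptyset$ for $i\neq j$. With $I=\{1,\dots,m\}$, $I^\infty$ the set of infinite sequences over $I$, and $\pi:I^\infty\to K$ the address map $\pi(\alpha)=\bigcap_{n}S_{\alpha_1}\cdots S_{\alpha_n}(K)$, the critical set is $C=\bigcup_{i\neq j}K_i\cap K_j$, and $\mathcal S$ is post-critically finite if the set of $\alpha\in I^\infty$ for which there exist $i_1,\dots,i_n$ with $S_{i_1}\cdots S_{i_n}(\pi(\alpha))\in C$ is finite. If $S_i$ has ratio $r_i$, the similarity dimension $s$ is the unique solution of $\sum_i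 r_i^s=1$. *)

(* Defs.v *)
From HB Require Import structures.
From mathcomp Require Import all_boot all_order all_algebra.
From mathcomp Require Import all_classical all_reals all_analysis.
From mathcomp Require Import Rstruct Rstruct_topology.
Set Implicit Arguments. Unset Strict Implicit. Unset Printing Implicit Defensive.
Import Order.TTheory GRing.Theory Num.Theory.
Import numFieldNormedType.Exports.
Local Open Scope classical_set_scope.
Local Open Scope ring_scope.

Notation RR := Rdefinitions.R.

Definition similarity (f : RR -> RR) (r : RR) : Prop :=
  forall x y : RR, `|f x - f y| = r * `|x - y|.

Definition contraction_similarity (f : RR -> RR) (r : RR) : Prop :=
  0 < r < 1 /\ similarity f r.

Definition is_attractor (m : nat) (S : 'I_m -> RR -> RR) (K : set RR) : Prop :=
  K !=set0 /\ compact K /\ K = \bigcup_(i in [set: 'I_m]) (S i @` K).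

Definition OSC (m : nat) (S : 'I_m -> RR -> RR) : Prop :=
  exists O : set RR, [/\ open O, O !=set0,
    (forall i, S i @` O `<=` O) &
    (forall i j, i != j -> S i @` O `&` S j @` O = set0)].

Definition word_map (m : nat) (S : 'I_m -> RR -> RR) (w : seq 'I_m) : RR -> RR :=
  foldr (fun i f => S i \o f) id w.

(* The address map pi : I^oo -> K, pi(alpha) = the point of
   \bigcap_n S_{alpha_1} ... S_{alpha_n}(K) (indices from 0). *)
Definition address_map (m : nat) (S : 'I_m -> RR -> RR) (K : set RR)
  (alpha : nat -> 'I_m) : RR :=
  xget 0 (\bigcap_(n in [set: nat])
            (word_map S [seq alpha k | k <- iota 0 n] @` K)).

Definition critical_set (m : nat) (S : 'I_m -> RR -> RR) (K : set RR) : set RR :=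
  \bigcup_(i in [set: 'I_m]) \bigcup_(j in [set j | j != i])
     (S i @` K `&` S j @` K).

Definition post_critically_finite (m : nat) (S : 'I_m -> RR -> RR) (K : set RR)
  : Prop :=
  finite_set [set alpha : nat -> 'I_m | exists w : seq 'I_m,
      (0 < size w)%N /\
      critical_set S K (word_map S w (address_map S K alpha))].

(* Diameter of a subset of R (extended real; -oo for the empty set). *)
Definition diam (U : set RR) : \bar RR :=
  ereal_sup [set (`|x - y|)%:E | x in U & y in U].

Definition diam_pow (s : RR) (U : set RR) : \bar RR :=
  if `[< U = set0 >] then 0%E else ((fine (diam U)) `^ s)%:E.

Definition hausdorff_content (delta s : RR) (A : set RR) : \bar RR :=
  ereal_inf [set (\sum_(0 <= k <oo) diam_pow s (U k))%E |
     U in [set U : nat -> set RR |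
        A `<=` \bigcup_(k in [set: nat]) U k /\
        forall k, (diam (U k) <= delta%:E)%E]].

Definition hausdorff_measure (s : RR) (A : set RR) : \bar RR :=
  ereal_sup [set hausdorff_content delta s A | delta in [set d : RR | 0 < d]].

Definition hausdorff_dim (A : set RR) : \bar RR :=
  ereal_inf [set s%:E | s in [set s : RR | 0 <= s /\ hausdorff_measure s A = 0%E]].

(* Main.v *)
Require Import Defs.
From HB Require Import structures.
From mathcomp Require Import all_boot all_order all_algebra.
From mathcomp Require Import all_classical all_reals all_analysis.
From mathcomp Require Import Rstruct Rstruct_topology.
From mathcomp Require Import finmap ring lra.
Import Order.TTheory GRing.Theory Num.Theory.
Import numFieldNormedType.Exports.
Local Open Scope classical_set_scope.
Local Open Scope ring_scope.
Set Implicit Arguments.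
Unset Strict Implicit.
Unset Printing Implicit Defensive.

(** The maps are x/100, 1/4 + x/100, 1/2 + x/1000, 1/2 + (1 - x)/100,
    3/4 - x/100 and 1 - b(1 - x).  The third and fourth pieces lie on the same
    side of their common point 1/2, where they are scaled copies of K and of
    1 - K near 0.  A transversality count shows that, for b outside a
    meagre set, no two of the small cylinders accumulating at 1/2 meet, while
    for generic b the ratio of 10^-3 100^-n to 10^-2 b^m comes arbitrarily
    close to 1, so that S_3 S_1^n S_2 and S_4 S_6^m S_5 almost coincide.  Almost
    coincidence refutes the open set condition; it also lets one cover serve
    two pieces, so the infimum h of the costs of covers of K satisfies
    (p + q) h <= p h + small for the masses p ~ q of these pieces, and
    H^s(K) = 0.
    Conversely, as 1/2 is the only contact, cylinders whose word ends in 2 are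
    pairwise disjoint at each level, which gives dim K >= t for all t < s. *)

(** Failure of the open set condition asks for pieces that nearly coincide, while the single contact
    forbids them to meet elsewhere. Both demands are countable families of conditions on [b], each
    valid on some subinterval of every admissible interval, so nested intervals satisfy them all at
    once. The ratios are small because of the count behind the first family: there are [36 ^ k]
    pairs of words of length [k], each pair excludes parameters inside an interval of length at most
    [2 / 100 ^ k], and [36 < 100]. Only the last ratio varies: the scale [b ^ m] on one side of the
    comparison must move with [b] while the scale on the other side stays fixed. The second and
    fifth maps satisfy [S_2 x = 1 - S_5 x = 1 / 4 + x / 100]; hence [S_3 S_1^n S_2 x - 1 / 2] and
    [S_4 S_6^m S_5 x - 1 / 2] are multiples of one function, with quotient
    [10 * 100 ^ n * b ^ m]. *)

(** * Similarities of the real line *)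

(** Polarization: the squared distances from [f x] to [f 0] and to [f 1] determine the product of
    [f x - f 0] with [f 1 - f 0]. *)
Lemma similarity_affine (f : RR -> RR) (r : RR) : 0 < r -> similarity f r ->
  exists2 m : RR, `|m| = r & forall x, f x = f 0 + m * x.
Proof.
move=> r0 fr; exists (f 1 - f 0); first by rewrite fr subr0 normr1 mulr1.
move=> x.
have sq z : `|z| ^+ 2 = z ^+ 2 :> RR by rewrite real_normK ?num_real.
have h1 : (f 1 - f 0) ^+ 2 = r ^+ 2 by rewrite -sq fr subr0 normr1 mulr1.
have h2 : (f x - f 0) ^+ 2 = r ^+ 2 * x ^+ 2 by rewrite -sq fr subr0 exprMn sq.
have h3 : (f x - f 1) ^+ 2 = r ^+ 2 * (x - 1) ^+ 2.
  by rewrite -sq fr exprMn sq.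
have m0 : f 1 - f 0 != 0 by rewrite -normr_gt0 fr subr0 normr1 mulr1.
have h4 : (f 1 - f 0) ^+ 2 * x = r ^+ 2 * x by rewrite h1.
by apply: (mulfI m0); lra.
Qed.

Lemma similarity_inverse (f : RR -> RR) (r : RR) : 0 < r -> similarity f r ->
  exists2 g : RR -> RR, similarity g r^-1 & forall x, g (f x) = x.
Proof.
move=> r0 fr; have [m mr fE] := similarity_affine r0 fr.
have m0 : m != 0 by rewrite -normr_gt0 mr.
exists (fun y => (y - f 0) / m) => [x y|x]; last first.
  by rewrite [in f x]fE; field.
by rewrite -mr -normfV -normrM; congr `| _ |; field.
Qed.

Lemma similarity_between (f : RR -> RR) (r a b x : RR) : 0 < r ->
  similarity f r -> a <= x <= b ->
  Num.min (f a) (f b) <= f x <= Num.max (f a) (f b).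
Proof.
move=> r0 fr /andP[ax xb]; have [m _ fE] := similarity_affine r0 fr.
rewrite [f a]fE [f b]fE [f x]fE ge_min le_max; have [m0|m0] := leP 0 m.
  by apply/andP; split; apply/orP; [left|right]; nra.
by apply/andP; split; apply/orP; [right|left]; nra.
Qed.

Lemma similarity_comp (f g : RR -> RR) (p q : RR) :
  similarity f p -> similarity g q -> similarity (f \o g) (p * q).
Proof. by move=> fp gq x y; rewrite /= fp gq mulrA. Qed.

Lemma similarity_continuous (f : RR -> RR) (r : RR) : 0 < r -> similarity f r ->
  continuous f.
Proof.
move=> r0 fr; have [m _ fE] := similarity_affine r0 fr.
rewrite (_ : f = fun x => f 0 + m * x); last exact/funext.
by move=> x; exact: (cvgD (cvg_cst _) (cvgM (cvg_cst _) cvg_id)).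
Qed.

Lemma similarity_inj (f : RR -> RR) (r : RR) : 0 < r -> similarity f r ->
  injective f.
Proof.
move=> r0 fr x y fxy; apply/eqP; rewrite -subr_eq0 -normr_eq0.
by have := fr x y; rewrite fxy subrr normr0 => /esym/eqP; rewrite mulf_eq0 gt_eqF.
Qed.

(** * Finite covers by closed intervals *)

Definition covers (l : seq (RR * RR)) (A : set RR) : Prop :=
  all (fun p => p.1 <= p.2) l /\
  forall x, A x -> exists2 p, p \in l & p.1 <= x <= p.2.

Definition interval_cost (s : RR) (l : seq (RR * RR)) : RR :=
  \sum_(p <- l) (p.2 - p.1) `^ s.

(** No bound is put on the lengths: at a positive exponent a small cost already forces every
    interval to be short. The costs therefore scale exactly under similarities. *)
Definition coverable (s : RR) (A : set RR) (c : RR) : Prop :=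
  exists2 l, covers l A & interval_cost s l <= c.

Lemma interval_cost_ge0 s l : 0 <= interval_cost s l.
Proof. by apply: sumr_ge0 => p _; exact: powR_ge0. Qed.

Lemma powR_le_interval_cost (s : RR) l p : p \in l ->
  (p.2 - p.1) `^ s <= interval_cost s l.
Proof.
move=> pl; rewrite /interval_cost (perm_big _ (perm_to_rem pl)) big_cons lerDl.
exact: interval_cost_ge0.
Qed.

Lemma covers_sub l A B : A `<=` B -> covers l B -> covers l A.
Proof. by move=> AB [lp lB]; split=> // x /AB /lB. Qed.

Lemma coverable_sub s A B c d : A `<=` B -> c <= d ->
  coverable s B c -> coverable s A d.
Proof.
move=> AB cd [l lB lc]; exists l; first exact: covers_sub lB.
exact: le_trans cd.
Qed.

Lemma coverable_ge0 s A c : coverable s A c -> 0 <= c.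
Proof. by case=> l _; exact/le_trans/interval_cost_ge0. Qed.

Lemma coverable_itv s a b : a <= b -> coverable s `[a, b] ((b - a) `^ s).
Proof.
move=> ab; exists [:: (a, b)]; last by rewrite /interval_cost big_seq1.
split=> [|x]; first by rewrite /= ab.
by rewrite /= in_itv /= => xab; exists (a, b); rewrite ?mem_head.
Qed.

Lemma coverable0 s : coverable s set0 0.
Proof. by exists [::]; [split|rewrite /interval_cost big_nil]. Qed.

Lemma coverableU s A B c d : coverable s A c -> coverable s B d ->
  coverable s (A `|` B) (c + d).
Proof.
move=> [l [l1 l2] lc] [k [k1 k2] kd]; exists (l ++ k); last first.
  by rewrite /interval_cost big_cat lerD.
split=> [|x]; first by rewrite all_cat l1.
by move=> [/l2|/k2] [p pl px]; exists p; rewrite // mem_cat pl ?orbT.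
Qed.

Lemma coverable_bigcup (I : finType) (P : pred I) s (A : I -> set RR)
    (c : I -> RR) :
  (forall i, P i -> coverable s (A i) (c i)) ->
  coverable s (\bigcup_(i in [set i | P i]) A i) (\sum_(i | P i) c i).
Proof.
move=> Ac; rewrite [X in coverable _ X _](_ : _ =
    \big[setU/set0]_(i | P i) A i); last first.
  rewrite -big_filter -bigcup_seq; apply/seteqP; split=> x [i Pi Ai];
    exists i => //=; first by rewrite mem_filter mem_index_enum andbT.
  by move: Pi; rewrite /= mem_filter => /andP[].
elim: (index_enum I) => [|i e IH].
  by rewrite !big_nil; exact: coverable0.
rewrite !big_cons; case: ifP => // Pi.
by apply: coverableU IH; exact: Ac.
Qed.

Lemma covers_image (f : RR -> RR) (r s : RR) l A : 0 < r -> similarity f r ->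
  covers l A ->
  exists2 k, covers k (f @` A) & size k = size l /\
    interval_cost s k = r `^ s * interval_cost s l.
Proof.
move=> r0 fr [l1 l2].
exists [seq (Num.min (f p.1) (f p.2), Num.max (f p.1) (f p.2)) | p <- l].
  split; first by rewrite all_map; apply/allP => p _ /=; rewrite ge_min !le_max
    lexx.
  move=> _ [x /l2[p pl px] <-]; exists
    (Num.min (f p.1) (f p.2), Num.max (f p.1) (f p.2)); first exact/mapP/(ex_intro2 _ _ p).
  exact: similarity_between r0 fr px.
split; first by rewrite size_map.
rewrite /interval_cost big_map mulr_sumr big_seq [RHS]big_seq.
apply: eq_bigr => p pl; rewrite -powRM ?(ltW r0)//; last first.
  by rewrite subr_ge0; exact: (allP l1).
congr (_ `^ _) => /=.
have p12 : 0 <= p.2 - p.1 by rewrite subr_ge0; exact: (allP l1).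
have := fr p.2 p.1; rewrite (ger0_norm p12) => <-;
  case: (leP (f p.1) (f p.2)) => h; first by rewrite ger0_norm ?subr_ge0.
by rewrite distrC ger0_norm ?subr_ge0 ?ltW.
Qed.

Lemma coverable_image (f : RR -> RR) (r s : RR) A c : 0 < r -> similarity f r ->
  coverable s A c -> coverable s (f @` A) (r `^ s * c).
Proof.
move=> r0 fr [l lA lc]; have [k kA [_ kc]] := covers_image s r0 fr lA.
by exists k => //; rewrite kc ler_wpM2l ?powR_ge0.
Qed.

(** The interval through the right endpoint is peeled off. The others are only known to cover points
    strictly left of it, hence the slack [e]. *)
Lemma itv_covers_length x y l : covers l `[x, y] ->
  y - x <= \sum_(p <- l) (p.2 - p.1).
Proof.
move: {2}(size l) (erefl (size l)) => n; elim: n l y => [|n IH] l y.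
  move=> /size0nil -> [_ lxy]; rewrite big_nil leNgt; apply/negP => xy.
  by case: (lxy x) => //=; rewrite in_itv /= lexx; lra.
move=> ln [l1 l2].
have pos : forall k : seq (RR * RR), all (fun p => p.1 <= p.2) k ->
    0 <= \sum_(p <- k) (p.2 - p.1) :> RR.
  move=> k /allP kp; rewrite big_seq; apply: sumr_ge0 => p /kp; rewrite subr_ge0//.
have [xy|yx] := leP x y; last by have := pos l l1; lra.
have [p pl /andP[p1y yp2]] : exists2 p, p \in l & p.1 <= y <= p.2.
  by apply: l2; rewrite /= in_itv /= xy lexx.
have perm := perm_to_rem pl; rewrite (perm_big _ perm) big_cons /=.
have l1' : all (fun p => p.1 <= p.2) (rem p l).
  by apply/allP => q /mem_rem; exact: (allP l1).
have [p1x|xp1] := leP p.1 x; first by have := pos _ l1'; lra.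
suff : p.1 - x <= \sum_(j <- rem p l) (j.2 - j.1) by lra.
rewrite lerBlDr; apply/ler_addgt0Pr => e e0.
suff : (p.1 - e) - x <= \sum_(j <- rem p l) (j.2 - j.1) by lra.
apply: IH; first by rewrite size_rem// ln.
split=> // z; rewrite /= in_itv /= => /andP[xz zp].
have [|q ql qz] := l2 z; first by rewrite /= in_itv /= xz; lra.
exists q => //; move: ql; rewrite (perm_mem perm) inE => /orP[/eqP qp|//].
by move: qz; rewrite qp; lra.
Qed.

(** A connected subset with two points [u < v] contains [[u, v]], whose covers have total length at
    least [v - u]. *)
Lemma totally_disconnected_coverable (A : set RR) :
  (forall c : RR, 0 < c -> coverable 1 A c) -> totally_disconnected A.
Proof.
move=> Ac x Ax; apply/seteqP; split=> [y|_ ->]; last first.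
  by apply: connected_component_refl.
case=> C [Cx CA Cc Cy]; move/connected_intervalP: Cc => Ci.
have key u v : C u -> C v -> ~ (u < v).
  move=> Cu Cv uv.
  have [|l lA lc] := Ac ((v - u) / 2); first by lra.
  have : covers l `[u, v].
    apply: covers_sub lA => z; rewrite /= in_itv /= => uzv.
    by apply: CA; apply: (Ci u v) => //; exact: uzv.
  move/itv_covers_length; move: lc; rewrite /interval_cost.
  rewrite (eq_big_seq (fun p => p.2 - p.1)); first by lra.
  move=> p pl; apply: powRr1; rewrite subr_ge0.
  by case: lA => /allP /(_ _ pl).
by case: (ltgtP x y) => // h; [case: (key x y)|case: (key y x)].
Qed.

Lemma subinterval_avoiding x y (l : seq (RR * RR)) : x < y ->
  all (fun p => p.1 <= p.2) l -> \sum_(p <- l) (p.2 - p.1) < y - x ->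
  exists u v, [/\ x <= u, u < v, v <= y &
    forall p z, p \in l -> u <= z <= v -> ~~ (p.1 <= z <= p.2)].
Proof.
move=> xy l1 lxy.
(* Thickening costs [2 * e] per interval and shrinking [[x, y]] at both ends costs [2 * e]; a
   further [2 * e] makes the comparison strict. A point missed by the thickened intervals is the
   centre of the wanted subinterval. *)
pose N : RR := (size l).*2.+4%:R.
pose e := (y - x - \sum_(p <- l) (p.2 - p.1)) / N.
have N0 : 0 < N by rewrite ltr0n.
have e0 : 0 < e by rewrite divr_gt0 ?subr_gt0.
have eN : e * N = y - x - \sum_(p <- l) (p.2 - p.1).
  by rewrite divfK// gt_eqF.
pose k := [seq (p.1 - e, p.2 + e) | p <- l].
have : ~ covers k `[x + e, y - e].
  move/itv_covers_length; rewrite big_map /=.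
  rewrite (eq_bigr (fun p : RR * RR => (p.2 - p.1) + e *+ 2)); last first.
    by move=> p _; rewrite mulr2n; lra.
  rewrite big_split /= big_const_seq count_predT iter_addr addr0 -mulrnA.
  rewrite -[e *+ _]mulr_natr mul2n => h.
  move: eN; rewrite /N -addn4 natrD mulrDr; lra.
move=> nk; have [z [xz zy zk]] : exists z, [/\ x + e <= z, z <= y - e &
    forall p, p \in k -> ~~ (p.1 <= z <= p.2)].
  apply: contrapT => nz; apply: nk; split.
    by rewrite all_map; apply/allP => p /(allP l1) /=; lra.
  move=> z; rewrite /= in_itv /= => /andP[xz zy]; apply: contrapT => nzk.
  apply: nz; exists z; split=> // p pk; apply/negP => pz; apply: nzk.
  by exists p.
exists (z - e), (z + e); split; [lra|lra|lra|].
move=> p w pl /andP[w1 w2].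
have := zk (p.1 - e, p.2 + e) (map_f _ pl).
by move=> /= /negP h; apply/negP => h'; apply: h; move: h'; lra.
Qed.

(** Used to enlarge sets of a cover to open intervals at small extra cost; [x = 0] is included for
    the sake of singletons. *)
Lemma powR_right_continuous (t x e : RR) : 0 <= t -> 0 <= x -> 0 < e ->
  exists2 h, 0 < h & forall y, 0 <= y <= x + h -> y `^ t <= x `^ t + e.
Proof.
rewrite le_eqVlt => /orP[/eqP <-|t0] x0 e0.
  by exists 1 => // y _; rewrite !powRr0; lra.
have z0 : 0 <= x `^ t + e by rewrite addr_ge0 ?powR_ge0 ?ltW.
have xz : x < (x `^ t + e) `^ t^-1.
  rewrite -[ltLHS](powRr1 x0) -(divff (lt0r_neq0 t0)) powRrM.
  apply: gt0_ltr_powR; rewrite ?invr_gt0 ?nnegrE ?powR_ge0//; lra.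
exists ((x `^ t + e) `^ t^-1 - x); first by rewrite subr_gt0.
move=> y /andP[y0]; rewrite addrC subrK => yz.
rewrite -[leRHS](powRr1 z0) -(mulVf (lt0r_neq0 t0)) powRrM.
by apply: ge0_ler_powR; rewrite ?nnegrE ?powR_ge0// ltW.
Qed.

(** * Hausdorff measure and finite interval covers *)

Lemma diam_itv (a b : RR) : a <= b -> diam `[a, b] = (b - a)%:E.
Proof.
move=> ab; apply/eqP; rewrite eq_le; apply/andP; split.
  apply: ge_ereal_sup => _ [x xab [y yab <-]].
  move: xab yab; rewrite /= !in_itv /= lee_fin => /andP[? ?] /andP[? ?].
  by rewrite ler_norml; apply/andP; split; lra.
apply: ereal_sup_ubound; exists b; first by rewrite /= in_itv /= ab lexx.
exists a; first by rewrite /= in_itv /= ab lexx.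
by rewrite ger0_norm ?subr_ge0.
Qed.

Lemma diam_pow_ge0 (s : RR) (U : set RR) : (0 <= diam_pow s U)%E.
Proof. by rewrite /diam_pow; case: ifP => // _; rewrite lee_fin powR_ge0. Qed.

Lemma hausdorff_content_ge0 (delta s : RR) (A : set RR) :
  (0 <= hausdorff_content delta s A)%E.
Proof.
apply: le_ereal_inf_tmp => _ [U _ <-].
by apply: nneseries_ge0 => k _ _; exact: diam_pow_ge0.
Qed.

Lemma hausdorff_content_le_cost (delta s : RR) (A : set RR) l :
  covers l A -> all (fun p => p.2 - p.1 <= delta) l ->
  (hausdorff_content delta s A <= (interval_cost s l)%:E)%E.
Proof.
move=> [l1 l2] ld; apply: ge_ereal_inf.
(* The list is padded with [set0]: its [diam] is [-oo], below every [delta], and its [diam_pow] is 0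
   at every exponent. *)
pose U k : set RR := if (k < size l)%N then
  `[(nth (0, 0) l k).1, (nth (0, 0) l k).2]%classic else set0.
exists (\sum_(0 <= k <oo) diam_pow s (U k))%E.
  exists U => //; split.
    move=> x /l2[p pl px]; exists (index p l) => //.
    by rewrite /U index_mem pl nth_index//= in_itv.
  move=> k; rewrite /U; case: ifP => kl.
    rewrite diam_itv; last exact: (allP l1) (mem_nth _ kl).
    by rewrite lee_fin; exact: (allP ld) (mem_nth _ kl).
  rewrite /diam [X in ereal_sup X](_ : _ = set0) ?ereal_sup0 ?leNye//.
  by apply/seteqP; split=> // y [].
rewrite (nneseries_split 0 (size l)); last by move=> k _; exact: diam_pow_ge0.
rewrite [X in (_ + X)%E]eseries0 ?adde0; last first.
  move=> k; rewrite add0n => lk _; rewrite /U ltnNge lk /= /diam_pow asboolT//.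
rewrite add0n /interval_cost (big_nth (0, 0)) -sumEFin.
rewrite big_nat [leRHS]big_nat; apply: lee_sum => k /andP[_ kl].
have kle := allP l1 _ (mem_nth (0, 0) kl).
rewrite /U kl /diam_pow; case: ifP => _; first by rewrite lee_fin powR_ge0.
by rewrite diam_itv.
Qed.

Lemma hausdorff_measure_eq0 (s : RR) (A : set RR) : 0 < s ->
  (forall c : RR, 0 < c -> coverable s A c) -> hausdorff_measure s A = 0%E.
Proof.
move=> s0 Ac; apply/eqP; rewrite eq_le; apply/andP; split; last first.
  apply: le_trans (hausdorff_content_ge0 1 s A) _.
  by apply: ereal_sup_ubound; exists 1 => //=; exact: ltr01.
apply: ge_ereal_sup => _ [d /= d0 <-]; apply/lee_addgt0Pr => e e0.
(* Cost at most the [s]-th power of [d] bounds every length by [d]. *)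
have c0 : 0 < Num.min e (d `^ s) by rewrite lt_min e0 powR_gt0.
have [l lA] := Ac _ c0; rewrite le_min => /andP[le ld].
rewrite add0e; apply: le_trans (_ : ((interval_cost s l)%:E <= _)%E); last first.
  by rewrite lee_fin.
apply: hausdorff_content_le_cost => //; apply/allP => p pl.
have p0 : 0 <= p.2 - p.1 by rewrite subr_ge0; case: lA => /allP ->.
rewrite leNgt; apply/negP => dp.
have : d `^ s < (p.2 - p.1) `^ s.
  by apply: gt0_ltr_powR; rewrite ?nnegrE// ltW.
have := powR_le_interval_cost s pl; lra.
Qed.

Lemma diam_interval (U : set RR) : U !=set0 -> (diam U <= 1%:E)%E ->
  0 <= fine (diam U) /\ exists a, U `<=` `[a, a + fine (diam U)].
Proof.
move=> [x Ux] U1.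
have ub y z : U y -> U z -> (`|y - z|%:E <= diam U)%E.
  by move=> Uy Uz; apply: ereal_sup_ubound; exists y => //; exists z.
have fU : diam U \is a fin_num.
  rewrite fin_numE; apply/andP; split; apply/eqP => h.
    by have := ub x x Ux Ux; rewrite h.
  by move: U1; rewrite h.
have ubf y z : U y -> U z -> y - fine (diam U) <= z.
  move=> Uy Uz; have := ub y z Uy Uz; rewrite -{1}(fineK fU) lee_fin ler_norml.
  by move=> /andP[_]; lra.
split; first by have := ubf x x Ux Ux; lra.
exists (inf U) => y Uy; rewrite /= in_itv /=; apply/andP; split.
  by apply: ge_inf => //; exists (x - fine (diam U)) => z Uz; exact: ubf.
rewrite -lerBlDr; apply: lb_le_inf; first by exists x.
by move=> z Uz; exact: ubf.
Qed.

Lemma sum_inv_pow2_le1 (n : nat) : \sum_(0 <= k < n) 2^-1 ^+ k.+1 <= 1 :> RR.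
Proof.
suff -> : \sum_(0 <= k < n) 2^-1 ^+ k.+1 = 1 - 2^-1 ^+ n :> RR.
  by rewrite gerBl exprn_ge0.
elim: n => [|n IH]; first by rewrite big_geq// expr0 subrr.
by rewrite big_nat_recr//= IH exprS; lra.
Qed.

(** A countable cover of cost below [c / 2] is enlarged to open intervals, the [k]-th at extra cost
    [c / 2 ^ k.+2], and compactness leaves finitely many. Empty members are dropped, since at
    [t = 0] any interval put around them would cost 1. *)
Lemma coverable_hausdorff_measure0 (t : RR) (A : set RR) :
  0 <= t -> compact A ->
  hausdorff_measure t A = 0%E -> forall c : RR, 0 < c -> coverable t A c.
Proof.
move=> t0 cA A0 c c0.
have : (hausdorff_content 1%R t A < (c / 2)%:E)%E.
  apply: (@le_lt_trans _ _ 0%E); last by rewrite lte_fin; lra.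
  by rewrite -A0; apply: ereal_sup_ubound; exists 1 => //=; exact: ltr01.
move=> /ereal_inf_lt[_ [U [AU Ud] <-] Uc].
pose v k := fine (diam_pow t (U k)).
have vE k : diam_pow t (U k) = (v k)%:E.
  by rewrite /v /diam_pow; case: ifP.
have v0 k : 0 <= v k by rewrite -lee_fin -vE diam_pow_ge0.
have e0 k : 0 < c / 2 * 2^-1 ^+ k.+1 :> RR by rewrite mulr_gt0 ?exprn_gt0//; lra.
have step k : exists p : RR * RR, U k !=set0 ->
    [/\ p.1 <= p.2, U k `<=` `]p.1, p.2[ &
      (p.2 - p.1) `^ t <= v k + c / 2 * 2^-1 ^+ k.+1].
  have [U0|U0] := pselect (U k !=set0); last by exists (0, 0).
  have [d0 [a Ua]] := diam_interval U0 (Ud k).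
  have [h h0 hle] := powR_right_continuous t0 d0 (e0 k).
  exists (a - h / 2, a + fine (diam (U k)) + h / 2) => _ /=; split; first lra.
    by move=> x /Ua; rewrite /= !in_itv /= => /andP[? ?]; lra.
  have -> : v k = fine (diam (U k)) `^ t.
    rewrite /v /diam_pow asboolF// => Uk0.
    by case: U0 => x; rewrite Uk0.
  by apply: hle; lra.
have [p pP] := choice step.
move: cA; rewrite compact_cover.
move=> /(_ _ [set k | U k !=set0] (fun k => `](p k).1, (p k).2[%classic)).
case=> [k _|x /AU[k _ Ukx]|D DU AD]; first exact: interval_open.
  have Uk0 : U k !=set0 by exists x.
  by exists k => //; have [_ + _] := pP k Uk0; exact.
have {}DU (k : nat) : k \in D -> U k !=set0 by move=> /DU /set_mem.
exists [seq p k | k <- D].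
  split; first by rewrite all_map; apply/allP => k /DU /pP[].
  move=> x /AD[k kD xk]; exists (p k); first exact: map_f.
  by move: xk; rewrite /= in_itv /= => /andP[/ltW -> /ltW ->].
rewrite /interval_cost big_map.
(* All indices of the finite subcover lie below [N], so its cost is compared with a partial sum of
   the series. *)
pose N := (\max_(k <- D) k).+1.
pose g k : RR := v k + c / 2 * 2^-1 ^+ k.+1.
have g0 k : 0 <= g k by rewrite addr_ge0// ltW.
apply: (@le_trans _ _ (\sum_(0 <= k < N) g k)).
  rewrite (perm_big [seq k <- index_iota 0 N | k \in D]); last first.
    apply: uniq_perm => [||k]; rewrite ?fset_uniq ?filter_uniq ?iota_uniq//.
    rewrite mem_filter mem_index_iota /=; case: (boolP (k \in D)) => //= kD.
    by rewrite /N ltnS; apply/esym; apply: (@leq_bigmax_seq _ _ _ id).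
  rewrite big_filter big_mkcond; apply: ler_sum => k _.
  by case: ifP => // /DU /pP[].
rewrite big_split /= -mulr_sumr.
have : \sum_(0 <= k < N) v k <= c / 2.
  rewrite -lee_fin; apply: le_trans (ltW Uc).
  rewrite -sumEFin; under eq_bigr do rewrite -vE.
  by apply: nneseries_lim_ge => k _ _; exact: diam_pow_ge0.
have := sum_inv_pow2_le1 N; nra.
Qed.

(** * Words, their maps and their ratios *)

Definition word_ratio (m : nat) (r : 'I_m -> RR) (w : seq 'I_m) : RR :=
  \prod_(i <- w) r i.

Lemma word_ratio_gt0 m (r : 'I_m -> RR) w : (forall i, 0 < r i) ->
  0 < word_ratio r w.
Proof. by move=> r0; apply: prodr_gt0 => i _. Qed.

Lemma word_map_similarity m (S : 'I_m -> RR -> RR) r w :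
  (forall i, similarity (S i) (r i)) ->
  similarity (word_map S w) (word_ratio r w).
Proof.
move=> Sr; elim: w => [|i w IH] x y; first by rewrite /word_ratio big_nil mul1r.
by rewrite /word_ratio big_cons; exact: similarity_comp.
Qed.

Lemma word_map_sub m (S : 'I_m -> RR -> RR) (A : set RR) w :
  (forall i, S i @` A `<=` A) -> word_map S w @` A `<=` A.
Proof.
move=> SA; elim: w => [|i w IH] _ [x Ax <-] //=.
by apply: SA; exists (word_map S w x) => //; apply: IH; exists x.
Qed.

Lemma word_map_cat m (S : 'I_m -> RR -> RR) u v x :
  word_map S (u ++ v) x = word_map S u (word_map S v x).
Proof. by elim: u => //= i u ->. Qed.

(** * The attractor as a greatest fixed point *)

(** The Knaster-Tarski form: the union of all subsets of [D] covered by their own images. A point is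
    placed in the attractor by exhibiting such a set, for instance the singleton of a fixed
    point. *)
Definition attractor_in (m : nat) (S : 'I_m -> RR -> RR) (D : set RR) :
    set RR :=
  \bigcup_(X in [set X | X `<=` D /\
    X `<=` \bigcup_(i in [set: 'I_m]) (S i @` X)]) X.

Lemma attractor_in_max m (S : 'I_m -> RR -> RR) (D X : set RR) :
  X `<=` D -> X `<=` \bigcup_(i in [set: 'I_m]) (S i @` X) ->
  X `<=` attractor_in S D.
Proof. by move=> XD XS x Xx; exists X. Qed.

Lemma attractor_in_sub m (S : 'I_m -> RR -> RR) (D : set RR) :
  attractor_in S D `<=` D.
Proof. by move=> x [X [XD _] /XD]. Qed.

Lemma attractor_in_fix m (S : 'I_m -> RR -> RR) (D : set RR) :
  (forall i, S i @` D `<=` D) ->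
  attractor_in S D = \bigcup_(i in [set: 'I_m]) (S i @` attractor_in S D).
Proof.
move=> SD; have sub : attractor_in S D `<=`
    \bigcup_(i in [set: 'I_m]) (S i @` attractor_in S D).
  move=> x [X [XD XS] Xx]; have [i _ [y Xy <-]] := XS _ Xx.
  by exists i => //; exists y => //; exists X.
apply/seteqP; split=> //; apply: attractor_in_max.
  move=> _ [i _ [y /attractor_in_sub Dy <-]].
  by apply: (SD i); exists y.
by move=> _ [i _ [y Ky <-]]; exists i => //; exists y => //; exact: sub.
Qed.

(** The closure of the attractor is again covered by its images, because a finite union of compact
    images is closed; by maximality it is the attractor itself. *)
Lemma attractor_in_compact m (S : 'I_m -> RR -> RR) (D : set RR) :
  (forall i, S i @` D `<=` D) -> (forall i, continuous (S i)) -> compact D ->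
  compact (attractor_in S D).
Proof.
move=> SD Sc cD; have clD : closed D := compact_closed (@Rhausdorff _) cD.
set K := attractor_in S D.
have KD : closure K `<=` D.
  rewrite [X in _ `<=` X]((closure_id D).1 clD); apply: closure_subset.
  exact: attractor_in_sub.
have cK : compact (closure K).
  exact: subclosed_compact (@closed_closure _ K) cD KD.
suff -> : K = closure K by [].
apply/seteqP; split; first exact: subset_closure.
apply: attractor_in_max => //.
have : closed (\bigcup_(i in [set: 'I_m]) (S i @` closure K)).
  apply: closed_bigcup; first exact: finite_finset.
  move=> i _; apply: compact_closed; first exact: Rhausdorff.
  apply: continuous_compact => //; exact: continuous_subspaceT.
move/closure_id => ->; apply: closure_subset.
rewrite {1}/K attractor_in_fix// => _ [i _ [y Ky <-]].
by exists i => //; exists y => //; exact: subset_closure.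
Qed.

(** * Near coincidences of pieces make the critical Hausdorff measure vanish *)

Lemma interval_cost_thicken (s h : RR) l : 0 <= s -> 0 < h ->
  all (fun p => p.1 <= p.2) l ->
  exists2 e, 0 < e & forall d, 0 <= d <= e ->
    interval_cost s [seq (p.1 - d, p.2 + d) | p <- l] <= interval_cost s l + h.
Proof.
move=> s0; rewrite /interval_cost; elim: l h => [|p l IH] h h0.
  by move=> _; exists 1 => // d _; rewrite !big_nil; lra.
move=> /= /andP[p12 lle].
have [|e e0 eP] := IH (h / 2) _ lle; first lra.
have [||k k0 kP] := @powR_right_continuous s (p.2 - p.1) (h / 2) s0; [lra|lra|].
exists (Num.min e (k / 2)); first by rewrite lt_min e0; lra.
move=> d; rewrite le_min => /and3P[d0 de dk].
rewrite !big_cons /=; have := eP d; rewrite d0 de => /(_ isT).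
by have := kP (p.2 + d - (p.1 - d)); lra.
Qed.

(** [R] collects the siblings of the pieces met along the path [u]. They are copies of [K], and
    since the masses of all children add up to 1, theirs add up to 1 minus the mass of [u]. *)
Lemma coverable_complement_piece m (S : 'I_m -> RR -> RR) r (s : RR)
    (K : set RR) (u : seq 'I_m) :
  (forall i, 0 < r i) -> (forall i, similarity (S i) (r i)) ->
  \sum_i r i `^ s = 1 -> K = \bigcup_(i in [set: 'I_m]) (S i @` K) ->
  exists2 R : set RR, K `<=` word_map S u @` K `|` R &
    forall c, coverable s K c -> coverable s R ((1 - word_ratio r u `^ s) * c).
Proof.
move=> r0 Sr sum1 KE; elim: u => [|i u [R KR Rc]].
  exists set0 => [x Kx|c _]; first by left; exists x.
  by rewrite /word_ratio big_nil powR1 subrr mul0r; exact: coverable0.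
exists (S i @` R `|` \bigcup_(j in [set j | j != i]) (S j @` K)).
  rewrite {1}KE => _ [j _ [y Ky <-]]; have [->|ji] := eqVneq j i; last first.
    by right; right; exists j => //; exists y.
  have [[z Kz <-]|Ry] := KR y Ky; first by left; exists z.
  by right; left; exists y.
move=> c Kc; pose T := \sum_(j | j != i) r j `^ s.
have sumT : r i `^ s + T = 1 by rewrite -sum1 (bigD1 i).
have -> : (1 - word_ratio r (i :: u) `^ s) * c =
    r i `^ s * ((1 - word_ratio r u `^ s) * c) + \sum_(j | j != i) r j `^ s * c.
  rewrite /word_ratio big_cons powRM; [|exact: ltW|exact/ltW/word_ratio_gt0].
  by rewrite -mulr_suml -/T (_ : T = 1 - r i `^ s); [ring|lra].
apply: coverableU; first exact/coverable_image/Rc.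
by apply: coverable_bigcup => j _; exact: coverable_image.
Qed.

(** The two nearly equal pieces lie in different first-level pieces [i] and [j], so what remains of
    [K] has mass exactly [1 - p - q]. The bound on the ratios keeps the saving, of order [q],
    comparable with the waste, of order [p]. *)
Lemma coverable_near_coincidences m (S : 'I_m -> RR -> RR) r (s : RR)
    (K : set RR) (i j : 'I_m) :
  (forall i, 0 < r i) -> (forall i, similarity (S i) (r i)) -> 0 <= s ->
  \sum_i r i `^ s = 1 -> K = \bigcup_(i in [set: 'I_m]) (S i @` K) ->
  (exists c, coverable s K c) -> i != j ->
  (forall e : RR, 0 < e -> exists u v,
    word_ratio r (i :: u) <= 2 * word_ratio r (j :: v) /\
    forall x, K x -> exists2 y, `|y - x| <= e &
      word_map S (j :: v) x = word_map S (i :: u) y) ->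
  forall c : RR, 0 < c -> coverable s K c.
Proof.
move=> r0 Sr s0 sum1 KE Kc ij near c c0.
pose C := [set c | coverable s K c].
have C0 : lbound C 0 by move=> x; exact: coverable_ge0.
have hC : has_inf C by split; [exact: Kc|exists 0].
set h := inf C.
have h0 : 0 <= h by apply: lb_le_inf.
have hle x : C x -> h <= x by apply: ge_inf; exists 0.
have [hpos|hneg] := ltP 0 h; last first.
  have [x Cx xc] := inf_adherent c0 hC.
  apply: coverable_sub Cx => //; rewrite -/h in xc; lra.
exfalso.
have p20 : 0 < 2%:R `^ s :> RR by apply: powR_gt0.
(* The final inequality reads [q * h <= 2 * eta * p]; as [p <= 2 ^ s * q], this choice of [eta]
   turns it into [h <= h / 2]. *)
pose eta := h / 2%:R `^ s / 4.
have eta0 : 0 < eta by rewrite !divr_gt0.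
have [x [l [l1 l2] lx] xh] := inf_adherent eta0 hC; rewrite -/h in xh.
have [e e0 eP] := interval_cost_thicken s0 eta0 l1.
have [u [v [uv near_uv]]] := near e e0.
set p := word_ratio r (i :: u) `^ s; set q := word_ratio r (j :: v) `^ s.
have ru0 w : 0 < word_ratio r w by exact: word_ratio_gt0.
have p0 : 0 < p by apply: powR_gt0.
have q0 : 0 < q by apply: powR_gt0.
have pq : p <= 2 `^ s * q.
  by rewrite /p /q -powRM ?(ltW (ru0 _))//; apply: ge0_ler_powR;
    rewrite ?nnegrE ?mulr_ge0 ?(ltW (ru0 _)).
(* one thickened cover of [S_u K] serves both [S_u K] and [S_v K] *)
have Puv : coverable s (word_map S (i :: u) @` K `|` word_map S (j :: v) @` K)
    (p * (h + eta + eta)).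
  pose k := [seq (p.1 - e, p.2 + e) | p <- l].
  pose Ke := [set y | exists2 x, K x & `|y - x| <= e].
  have kK : covers k Ke.
    split; first by rewrite all_map; apply/allP => z /(allP l1) /=; lra.
    move=> y [z /l2[a al az] yz]; exists (a.1 - e, a.2 + e).
      exact: (map_f (fun p => (p.1 - e, p.2 + e))).
    by move: yz az; rewrite ler_norml /=; lra.
  have : coverable s Ke (h + eta + eta).
    exists k => //; have := eP e; rewrite lexx (ltW e0) => /(_ isT); lra.
  move/(coverable_image (ru0 (i :: u)) (word_map_similarity (i :: u) Sr)).
  apply: coverable_sub => // _ [[y Ky <-]|[y Ky <-]].
    by exists y => //; exists y; rewrite // subrr normr0 ltW.
  by have [z zy ->] := near_uv y Ky; exists z => //; exists y.
have [R KR Rc] := coverable_complement_piece u r0 Sr sum1 KE.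
have [R' KR' R'c] := coverable_complement_piece v r0 Sr sum1 KE.
pose T := \sum_(k | (k != i) && (k != j)) r k `^ s.
have sumT : r i `^ s + r j `^ s + T = 1.
  by rewrite -sum1 (bigD1 i)//= (bigD1 j) 1?eq_sym//= addrA.
have bound y : C y -> h <= p * (h + eta + eta) + (1 - p - q) * y.
  move=> Cy; apply: hle.
  have -> : p * (h + eta + eta) + (1 - p - q) * y = p * (h + eta + eta) +
      (r i `^ s * ((1 - word_ratio r u `^ s) * y) +
       (r j `^ s * ((1 - word_ratio r v `^ s) * y) +
        \sum_(k | (k != i) && (k != j)) r k `^ s * y)).
    rewrite /p /q /word_ratio !big_cons.
    rewrite !powRM; try exact/ltW/word_ratio_gt0; try exact/ltW.
    by rewrite -mulr_suml -/T (_ : T = 1 - r i `^ s - r j `^ s); [ring|lra].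
  apply: coverable_sub (lexx _) _; last first.
    apply: coverableU Puv _.
    apply: coverableU (coverable_image (r0 i) (Sr i) (Rc y Cy)) _.
    apply: coverableU (coverable_image (r0 j) (Sr j) (R'c y Cy)) _.
    by apply: coverable_bigcup => k _; exact: coverable_image (r0 k) (Sr k) Cy.
  rewrite {1}KE => _ [k _ [z Kz <-]].
  have [->|ki] := eqVneq k i.
    by have [[w Kw <-]|Rz] := KR z Kz; [left; left; exists w|right; left; exists z].
  have [->|kj] := eqVneq k j.
    have [[w Kw <-]|Rz] := KR' z Kz; first by left; right; exists w.
    by right; right; left; exists z.
  by right; right; right; exists k; [rewrite /= ki|exists z].
(* The sign of this coefficient lets [y] decrease to the infimum [h] in [bound]. *)
have pq1 : 0 <= 1 - p - q.
  have T0 : 0 <= T by apply: sumr_ge0 => k _; exact: powR_ge0.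
  have le1 w : word_ratio r w `^ s <= 1.
    elim: w => [|k w IH]; first by rewrite /word_ratio big_nil powR1.
    rewrite /word_ratio big_cons powRM; [|exact: ltW|exact/ltW/word_ratio_gt0].
    have : r k `^ s <= 1.
      rewrite -sum1 (bigD1 k)//= lerDl; apply: sumr_ge0 => ? _; exact: powR_ge0.
    have := powR_ge0 (word_ratio r w) s; have := powR_ge0 (r k) s.
    by move: IH; rewrite /word_ratio; nra.
  have : p <= r i `^ s.
    rewrite /p /word_ratio big_cons powRM; [|exact: ltW|exact/ltW/word_ratio_gt0].
    by rewrite ger_pMr ?powR_gt0//; exact: le1.
  have : q <= r j `^ s.
    rewrite /q /word_ratio big_cons powRM; [|exact: ltW|exact/ltW/word_ratio_gt0].
    by rewrite ger_pMr ?powR_gt0//; exact: le1.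
  by lra.
have : h <= p * (h + eta + eta) + (1 - p - q) * h.
  apply/ler_addgt0Pr => d d0; have [y Cy yd] := inf_adherent d0 hC.
  have := bound y Cy; rewrite -/h in yd; nra.
have etaE : eta * 4 * 2 `^ s = h.
  by rewrite /eta; field; rewrite gt_eqF.
move: etaE hpos eta0 p20 pq q0 p0; move: (2 `^ s) => z; nra.
Qed.

(** * Lower bound for separated families *)

Lemma count_le1 (T : eqType) (a : pred T) (s : seq T) : uniq s ->
  {in s &, forall x y, a x -> a y -> x = y} -> (count a s <= 1)%N.
Proof.
rewrite -size_filter => us sa.
have : forall x y, x \in seq.filter a s -> y \in seq.filter a s -> x = y.
  by move=> x y; rewrite !mem_filter => /andP[ax xs] /andP[ay ys]; exact: sa.
have := filter_uniq a us; case: (seq.filter a s) => [//|x [//|y e]].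
move=> /= /andP[/negP nx _] /(_ x y); rewrite !inE !eqxx orbT => /(_ isT isT) xy.
by case: nx; rewrite xy mem_head.
Qed.

(* A cover by intervals shorter than the gap splits into covers of the
   individual pieces, each with fewer intervals: hence induction on the size. *)
Lemma interval_cost_separated (I : eqType) (W : seq I) (T : I -> RR -> RR)
    (rho : I -> RR) (K : set RR) (t d : RR) : uniq W -> (1 < size W)%N ->
  (forall i, 0 < rho i) -> (forall i, similarity (T i) (rho i)) ->
  (forall i, T i @` K `<=` K) -> K !=set0 -> 0 <= t -> 0 < d ->
  {in W &, forall i j x y, i != j -> K x -> K y -> d <= `|T i x - T j y|} ->
  1 <= \sum_(i <- W) rho i `^ t ->
  forall l, covers l K -> d `^ t <= interval_cost t l.
Proof.
move=> uW W1 rho0 Trho TK [x0 Kx0] t0 d0 sep sum1 l.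
move: {2}(size l).+1 (ltnSn (size l)) => n; elim: n l => // n IH l ln lK.
have [/hasP[p pl dp]|/hasPn short] := boolP (has (fun p => d <= p.2 - p.1) l).
  apply: le_trans (powR_le_interval_cost t pl).
  by apply: ge0_ler_powR; rewrite ?nnegrE ?(ltW d0)// (le_trans _ dp) ?ltW.
have [l1 l2] := lK.
pose meets i p := `[< exists2 x, K x & p.1 <= T i x <= p.2 >].
have uniq_meets p : p \in l -> {in W &, forall i j, meets i p -> meets j p -> i = j}.
  move=> pl i j iW jW /asboolP[x Kx px] /asboolP[y Ky py]; apply/eqP/negPn/negP => ij.
  have := sep i j iW jW x y ij Kx Ky; have := short p pl; rewrite -ltNge => pd.
  have : `|T i x - T j y| <= p.2 - p.1 by rewrite ler_norml; lra.
  by lra.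
(* Some other piece [j] needs an interval too, and that interval cannot meet piece [i]. *)
have smaller i : i \in W -> (size (seq.filter (meets i) l) < size l)%N.
  move=> iW; have [j jW ji] : exists2 j, j \in W & j != i.
    move: W1 uW; case: (W) => [//|a [//|b e]] _ /= /andP[+ _].
    rewrite inE negb_or => /andP[ab _].
    have [ai|ai] := eqVneq a i; last by exists a; rewrite ?mem_head.
    by exists b; rewrite ?inE ?eqxx ?orbT// -ai eq_sym.
  have [|p pl pj] := l2 (T j x0); first by apply: (TK j); exists x0.
  rewrite size_filter ltn_neqAle count_size andbT -all_count.
  apply/negP => /allP /(_ p pl) pi; case/eqP: ji.
  by apply: (uniq_meets p) => //; apply/asboolP; exists x0.
have piece i : i \in W -> rho i `^ t * d `^ t <= interval_cost t (seq.filter (meets i) l).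
  move=> iW; have [g gr gK] := similarity_inverse (rho0 i) (Trho i).
  have cov : covers (seq.filter (meets i) l) (T i @` K).
    split; first by apply/allP => p; rewrite mem_filter => /andP[_]; exact: (allP l1).
    move=> _ [x Kx <-]; have [|p pl px] := l2 (T i x); first by apply: (TK i); exists x.
    by exists p => //; rewrite mem_filter pl andbT; apply/asboolP; exists x.
  have ri0 : 0 < (rho i)^-1 by rewrite invr_gt0.
  have [k kK [ks kc]] := covers_image t ri0 gr cov.
  have : d `^ t <= interval_cost t k.
    apply: IH; first by rewrite ks (leq_trans (smaller _ iW)).
    by apply: covers_sub kK => x Kx; exists (T i x) => //; exists x.
  rewrite kc => h.
  have rt0 : 0 <= rho i `^ t by exact: powR_ge0.
  apply: le_trans (ler_wpM2l rt0 h) _.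
  rewrite mulrA -powRM ?(ltW (rho0 i)) ?(ltW ri0)//.
  by rewrite divff ?(lt0r_neq0 (rho0 i))// powR1 mul1r.
(* After exchanging the sums, each interval is counted for at most one piece. *)
have : \sum_(i <- W) interval_cost t (seq.filter (meets i) l) <= interval_cost t l.
  rewrite /interval_cost; under eq_bigr do rewrite big_filter big_mkcond.
  rewrite exchange_big /= big_seq [leRHS]big_seq; apply: ler_sum => p pl.
  rewrite -big_mkcond /= big_const_seq iter_addr addr0.
  have := count_le1 uW (uniq_meets p pl).
  case: (count _ W) => [|[|//]] _; first by rewrite mulr0n powR_ge0.
  by rewrite mulr1n.
apply: le_trans; apply: (@le_trans _ _ (\sum_(i <- W) rho i `^ t * d `^ t)).
  by rewrite -mulr_suml ler_peMl// powR_ge0.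
by rewrite big_seq [leRHS]big_seq; apply: ler_sum.
Qed.

Lemma compact_disjoint_gap (A B : set RR) : compact A -> compact B ->
  A `&` B = set0 -> exists2 d, 0 < d & forall x y, A x -> B y -> d <= `|x - y|.
Proof.
move=> cA cB AB0.
have oB : open (~` B) by apply: closed_openC; exact: compact_closed (@Rhausdorff _) cB.
have [e /= e0 eP] : \forall e \near 0^'+, A `<=` (fun x => forall y, B y -> e <= `|x - y|).
  move/compact_near_coveringP: cA; apply => x Ax.
  have nBx : (~` B) x by move=> Bx; have : (A `&` B) x by []; rewrite AB0.
  have [d /= d0 dB] := (nbhs_ballP _ _).1 (open_nbhs_nbhs (conj oB nBx)).
  exists (ball x (d / 2), [set e | e < d / 2]) => /=.
    split; first by apply: nbhsx_ballx; lra.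
    by apply: nbhs_right_lt; lra.
  move=> [z e] /= [xz ed] y By; rewrite leNgt; apply/negP => zy.
  apply: (dB y) By; rewrite /ball /= in xz *.
  have := ler_distD z x y; lra.
exists (e / 2) => [|x y Ax By]; first by lra.
apply: (eP (e / 2)) => //=; last by lra.
by rewrite sub0r normrN ger0_norm; lra.
Qed.

Lemma seq_common_gap (T : eqType) (l : seq T) (P : T -> RR -> Prop) :
  (forall x d e, e <= d -> P x d -> P x e) ->
  (forall x, x \in l -> exists2 d, 0 < d & P x d) ->
  exists2 d, 0 < d & forall x, x \in l -> P x d.
Proof.
move=> Pmono; elim: l => [_|a l IH lP]; first by exists 1.
have [d d0 dP] : exists2 d, 0 < d & forall x, x \in l -> P x d.
  by apply: IH => x xl; apply: lP; rewrite inE xl orbT.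
have [e e0 eP] := lP a (mem_head _ _).
exists (Num.min d e) => [|x]; first by rewrite lt_min d0.
rewrite inE => /orP[/eqP ->|xl].
  by apply: Pmono eP; rewrite ge_min lexx orbT.
by apply: Pmono (dP x xl); rewrite ge_min lexx.
Qed.

Fixpoint words (m n : nat) : seq (seq 'I_m) :=
  if n is k.+1 then [seq i :: w | i <- enum 'I_m, w <- words m k] else [:: [::]].

Lemma mem_words m n w : (w \in words m n) = (size w == n).
Proof.
elim: n w => [|n IH] [|i w] //=.
  by apply/negbTE/negP => /allpairsP[[a b] [_ _]].
rewrite eqSS -IH; apply/allpairsP/idP => [[[a b] /= [_ bw [_ ->]]]//|wn].
by exists (i, w); rewrite /= mem_enum.
Qed.

Lemma words_uniq m n : uniq (words m n).
Proof.
elim: n => //= n IH; apply: allpairs_uniq => //; first exact: enum_uniq.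
by move=> [a b] [c d] _ _ /= [-> ->].
Qed.

Lemma size_words m n : size (words m n) = (m ^ n)%N.
Proof.
by elim: n => //= n IH; rewrite size_allpairs IH size_enum_ord expnS.
Qed.

Lemma sum_words m n (F : 'I_m -> RR) :
  \sum_(w <- words m n) \prod_(i <- w) F i = (\sum_i F i) ^+ n.
Proof.
elim: n => [|n IH]; first by rewrite big_seq1 big_nil expr0.
rewrite [words _ _]/= big_allpairs_dep exprS mulr_suml -[RHS]big_enum /=.
apply: eq_bigr => i _; rewrite -IH mulr_sumr; apply: eq_bigr => w _.
by rewrite big_cons.
Qed.

Lemma word_ratio_powR m (r : 'I_m -> RR) (t : RR) w : (forall i, 0 < r i) ->
  word_ratio r w `^ t = \prod_(i <- w) r i `^ t.
Proof.
move=> r0; rewrite /word_ratio; elim: w => [|i w IH].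
  by rewrite !big_nil powR1.
rewrite !big_cons powRM ?IH//; [exact: ltW|exact/ltW/word_ratio_gt0].
Qed.

Lemma power_escape (q M : RR) : 1 < q -> exists2 m, (0 < m)%N & M < q ^+ m.
Proof.
move=> q1; have q0 : 0 < q - 1 by lra.
have [N] : exists N : nat, `|M| / (q - 1) < N%:R.
  by eexists; apply: archi_boundP; apply: divr_ge0; rewrite ?normr_ge0// ltW.
rewrite ltr_pdivrMr// => h; exists N.+1 => //.
have ber : forall k : nat, 1 + k%:R * (q - 1) <= q ^+ k.
  elim=> [|k IH]; first by rewrite mul0r expr0; lra.
  have y1 : 0 <= q by lra.
  have qy : 0 <= k%:R * (q - 1) ^+ 2 by rewrite mulr_ge0 ?ler0n ?sqr_ge0.
  by have := ler_wpM2l y1 IH; rewrite exprS -natr1; lra.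
have := ber N.+1; rewrite -natr1; have := ler_norm M; lra.
Qed.

(** Appending the letter [k] separates the words of length [n] at the price of one fixed factor in
    the total mass. Since the [t]-masses of the letters sum to more than 1, that sum to the power
    [n] outweighs the factor for large [n]. *)
Lemma hausdorff_measure_neq0 m (S : 'I_m -> RR -> RR) r (t : RR) (K : set RR)
    (k : 'I_m) : (1 < m)%N ->
  (forall i, 0 < r i) -> (forall i, similarity (S i) (r i)) -> 0 <= t ->
  1 < \sum_i r i `^ t -> (forall i, S i @` K `<=` K) -> compact K -> K !=set0 ->
  (forall u v, size u = size v -> u != v ->
    word_map S (rcons u k) @` K `&` word_map S (rcons v k) @` K = set0) ->
  hausdorff_measure t K <> 0%E.
Proof.
move=> m1 r0 Sr t0 sum1 SK cK K0 disj H0.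
pose s1 := \sum_i r i `^ t.
have rk0 : 0 < r k `^ t by apply: powR_gt0.
have [n n0] := power_escape (r k `^ t)^-1 sum1.
rewrite -/s1 -[ltLHS]mul1r ltr_pdivrMr// mulrC => /ltW nP.
pose T (w : seq 'I_m) := word_map S (rcons w k).
pose rho w := word_ratio r (rcons w k).
have rho0 w : 0 < rho w by exact: word_ratio_gt0.
have Trho w : similarity (T w) (rho w) by exact: word_map_similarity.
have TK w : T w @` K `<=` K by exact: word_map_sub.
have cT w : compact (T w @` K).
  apply: continuous_compact => //; apply: continuous_subspaceT.
  exact: similarity_continuous (rho0 w) (Trho w).
pose pairs := [seq (u, v) | u <- words m n, v <- words m n].
have [d d0 dP] : exists2 d, 0 < d & forall p, p \in pairs ->
    p.1 != p.2 -> forall x y, K x -> K y -> d <= `|T p.1 x - T p.2 y|.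
  apply: seq_common_gap => [p a b ba h p12 x y Kx Ky|p].
    exact: le_trans ba (h p12 x y Kx Ky).
  move=> /allpairsP[[u v] /= [un vn ->]] /=.
  have [uv|uv] := eqVneq u v; first by exists 1.
  have [|d d0 dP] := compact_disjoint_gap (cT u) (cT v).
    by apply: disj => //; move: un vn; rewrite !mem_words => /eqP -> /eqP ->.
  by exists d => // _ x y Kx Ky; apply: dP; [exists x|exists y].
have dt0 : 0 < d `^ t by apply: powR_gt0.
have c0 : 0 < d `^ t / 2 by lra.
have [l lK lc] := coverable_hausdorff_measure0 t0 cK H0 c0.
suff : d `^ t <= interval_cost t l by lra.
apply: (interval_cost_separated (words_uniq m n) _ rho0 Trho TK K0 t0 d0) lK.
- rewrite size_words -[1%N](exp1n n) ltn_exp2r//.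
- move=> u v un vn x y uv Kx Ky; apply: (dP (u, v)) => //.
  by apply/allpairsP; exists (u, v).
- apply: le_trans nP _; rewrite /s1 -sum_words mulr_sumr.
  apply: ler_sum => w _; rewrite /rho word_ratio_powR// big_rcons /=.
  by rewrite mulrC.
Qed.

(** * Generic parameters by nested intervals *)

(** Baire's argument: condition number [j] is secured at stage [j] on a closed subinterval, and the
    supremum of the left ends lies in all of them. *)
Lemma nested_intervals_generic (I : countType) (P : I -> RR -> Prop)
    (x y : RR) :
  x < y ->
  (forall i u v, x <= u -> u < v -> v <= y -> exists u' v',
    [/\ u <= u', u' < v', v' <= v & forall z, u' <= z <= v' -> P i z]) ->
  exists2 z, x <= z <= y & forall i, P i z.
Proof.
move=> xy dense.
have step (j : nat) (p : RR * RR) : exists q : RR * RR,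
    x <= p.1 -> p.1 < p.2 -> p.2 <= y ->
    [/\ p.1 <= q.1, q.1 < q.2, q.2 <= p.2 & forall i z,
      choice.unpickle j = Some i -> q.1 <= z <= q.2 -> P i z].
  (* A number that codes no condition leaves the interval unchanged. *)
  case E : (choice.unpickle j : option I) => [i|]; last first.
    by exists p => h1 h2 h3; split.
  have [[h1 [h2 h3]]|h] := pselect (x <= p.1 /\ p.1 < p.2 /\ p.2 <= y).
    have [u [v [? ? ? uvP]]] := dense i _ _ h1 h2 h3.
    by exists (u, v) => _ _ _; split=> // _ z [<-]; exact: uvP.
  by exists p => h1 h2 h3; case: h.
have [F FP] : {F : nat -> RR * RR -> RR * RR & forall j p,
    x <= p.1 -> p.1 < p.2 -> p.2 <= y ->
    [/\ p.1 <= (F j p).1, (F j p).1 < (F j p).2, (F j p).2 <= p.2 & forall i z,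
      choice.unpickle j = Some i -> (F j p).1 <= z <= (F j p).2 -> P i z]}.
  have h j := choice (step j).
  by exists (fun j => projT1 (h j)) => j p; exact: (projT2 (h j)).
pose J := fix J n := if n is k.+1 then F k (J k) else (x, y).
have JP n : [/\ x <= (J n).1, (J n).1 < (J n).2 & (J n).2 <= y].
  elim: n => [|n [h1 h2 h3]] /=; first by split.
  by have [? ? ? _] := FP n _ h1 h2 h3; split=> //; lra.
have Jmono n k : (J n).1 <= (J (n + k)%N).1 /\ (J (n + k)%N).2 <= (J n).2.
  elim: k => [|k [h1 h2]]; first by rewrite addn0.
  rewrite addnS /=; have [a1 a2 a3] := JP (n + k)%N.
  by have [? ? ? _] := FP (n + k)%N _ a1 a2 a3; lra.
have cross n k : (J n).1 <= (J k).2.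
  have [h1 _] := Jmono n k; have [_ h2] := Jmono k n.
  by have [_ + _] := JP (n + k)%N; rewrite addnC in h2; lra.
pose A := [set (J n).1 | n in [set: nat]].
have Aub k : ubound A (J k).2 by move=> _ [n _ <-]; exact: cross.
have A0 : A !=set0 by exists x; exists 0%N.
have hA : has_sup A by split=> //; exists y; exact: (Aub 0%N).
have zJ k : (J k).1 <= sup A <= (J k).2.
  apply/andP; split; last exact: ge_sup.
  by apply: ub_le_sup; [exact: hA.2|exists k].
exists (sup A); first exact: (zJ 0%N).
move=> i; have [h1 h2 h3] := JP (choice.pickle i).
have [_ _ _ h] := FP (choice.pickle i) _ h1 h2 h3.
by apply: h; [exact: choice.pickleK|exact: (zJ (choice.pickle i).+1)].
Qed.

(** * The one-parameter family of systems *)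

Definition ifs_offset (b : RR) (i : 'I_6) : RR :=
  nth 0 [:: 0; 1 / 4; 1 / 2; 1 / 2 + 1 / 100; 3 / 4; 1 - b] i.

Definition ifs_slope (b : RR) (i : 'I_6) : RR :=
  nth 0 [:: 1 / 100; 1 / 100; 1 / 1000; - (1 / 100); - (1 / 100); b] i.

Definition ifs_ratio (b : RR) (i : 'I_6) : RR :=
  nth 0 [:: 1 / 100; 1 / 100; 1 / 1000; 1 / 100; 1 / 100; b] i.

Definition ifs (b : RR) (i : 'I_6) (x : RR) : RR :=
  ifs_offset b i + ifs_slope b i * x.

Definition admissible (b : RR) : Prop := 1 / 300 <= b <= 1 / 200.

Lemma ifs_ratio_bounds b i : admissible b -> 0 < ifs_ratio b i <= 1 / 100.
Proof.
by rewrite /admissible /ifs_ratio; case: i => [[|[|[|[|[|[|//]]]]]] ?] /=; lra.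
Qed.

Lemma ifs_slope_norm b i : admissible b -> `|ifs_slope b i| = ifs_ratio b i.
Proof.
rewrite /admissible /ifs_ratio /ifs_slope => ab.
by case: i => [[|[|[|[|[|[|//]]]]]] ?] /=; rewrite ?normrN; apply: ger0_norm; lra.
Qed.

Lemma ifs_similarity b i : admissible b -> similarity (ifs b i) (ifs_ratio b i).
Proof.
move=> ab x y; rewrite -ifs_slope_norm// -normrM /ifs; congr `| _ |; ring.
Qed.

Lemma ifs_unit b i x : admissible b -> 0 <= x <= 1 -> 0 <= ifs b i x <= 1.
Proof.
rewrite /admissible /ifs /ifs_offset /ifs_slope.
by case: i => [[|[|[|[|[|[|//]]]]]] ?] /=; nra.
Qed.

Lemma ifs_word_unit b w x : admissible b -> 0 <= x <= 1 ->
  0 <= word_map (ifs b) w x <= 1.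
Proof. by move=> ab x01; elim: w => //= i w IH; exact: ifs_unit. Qed.

Lemma ifs_lipschitz b b' i x x' : admissible b -> admissible b' ->
  0 <= x <= 1 -> 0 <= x' <= 1 ->
  `|ifs b i x - ifs b' i x'| <= 1 / 100 * `|x - x'| + `|b - b'|.
Proof.
move=> ab ab' x01 x01'.
have -> : ifs b i x - ifs b' i x' = ifs_slope b i * (x - x') +
    (ifs_offset b i - ifs_offset b' i + (ifs_slope b i - ifs_slope b' i) * x').
  by rewrite /ifs; ring.
apply: le_trans (ler_normD _ _) _; apply: lerD.
  rewrite normrM ifs_slope_norm//; apply: ler_wpM2r => //.
  by case/andP: (ifs_ratio_bounds i ab).
case: i => [[|[|[|[|[|[|//]]]]]] ?]; rewrite /ifs_offset /ifs_slope /= ?subrr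
  ?mul0r ?addr0 ?normr0 ?normr_ge0//.
have -> : 1 - b - (1 - b') + (b - b') * x' = (b - b') * (x' - 1) by ring.
rewrite normrM ler_piMr// ler_norml; lra.
Qed.

(** Each letter adds at most [|b - b'|] and contracts what was accumulated by 1/100, so the factor 2
    bounds the geometric series whatever the length of [w]. *)
Lemma ifs_word_lipschitz b b' w x x' : admissible b -> admissible b' ->
  0 <= x <= 1 -> 0 <= x' <= 1 ->
  `|word_map (ifs b) w x - word_map (ifs b') w x'| <=
    (1 / 100) ^+ size w + 2 * `|b - b'|.
Proof.
move=> ab ab' x01 x01'; elim: w => [|i w IH] /=.
  have : `|x - x'| <= 1 by rewrite ler_norml; lra.
  by have := normr_ge0 (b - b'); rewrite expr0; lra.
apply: le_trans (ifs_lipschitz i ab ab' (ifs_word_unit w ab x01)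
  (ifs_word_unit w ab' x01')) _.
by have := normr_ge0 (b - b'); rewrite exprS; lra.
Qed.

(* The cylinders of [u] and [v] are rescaled as they sit at the contact point
   [1 / 2] inside [S_3 S_1^n K] and [S_4 S_6^m K]; the two bounds keep them in
   [K \ S_1 K] and [K \ S_6 K]. *)
Definition cylinders_meet (n m : nat) (u v : seq 'I_6) (b : RR) : Prop :=
  exists x y, [/\ 0 <= x <= 1, 0 <= y <= 1,
    1 / 4 <= word_map (ifs b) u x, word_map (ifs b) v y <= 3 / 4 &
    1 / 1000 * (1 / 100) ^+ n * word_map (ifs b) u x =
    1 / 100 * b ^+ m * (1 - word_map (ifs b) v y)].

(* The factor [b ^+ m] varies faster with [b] than the cylinders do. *)
Lemma cylinders_meet_close n m u v b b' : (0 < m)%N -> size u = size v ->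
  admissible b -> admissible b' -> b <= b' ->
  cylinders_meet n m u v b -> cylinders_meet n m u v b' ->
  b' - b <= (1 / 100) ^+ size u.
Proof.
move=> m0 suv ab ab' bb' [x [y [x01 y01 xu yv E]]] [x' [y' [x01' y01' xu' yv' E']]].
have LX := ifs_word_lipschitz u ab' ab x01' x01.
have LY := ifs_word_lipschitz v ab' ab y01' y01.
have := ifs_word_unit u ab x01; have := ifs_word_unit u ab' x01'.
have := ifs_word_unit v ab y01; have := ifs_word_unit v ab' y01'.
move: LX LY E E' xu yv xu' yv'; rewrite -suv (ger0_norm (_ : 0 <= b' - b)) ?subr_ge0//.
move: (word_map (ifs b) u x) (word_map (ifs b') u x') => X X'.
move: (word_map (ifs b) v y) (word_map (ifs b') v y') => V V'.
move: ((1 / 100) ^+ size u) => e.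
rewrite !ler_norml => LX LY E E' X4 V4 X4' V4' V01' V01 X01' X01.
have b0 : 0 < b by move: ab; rewrite /admissible; lra.
have bm0 : 0 < b ^+ m by apply: exprn_gt0.
(* Divided by [b ^ m.+1], this says that [b' / b] is at most its [m]-th power, for [m] positive. *)
have mono : b ^+ m * b' <= b' ^+ m * b.
  case: m m0 {E E' bm0} => // m _; rewrite !exprS.
  have : b ^+ m <= b' ^+ m by apply: lerXn2r; rewrite ?nnegrE; lra.
  by move=> h; have : 0 <= b * b' * (b' ^+ m - b ^+ m);
    [rewrite mulr_ge0//; nra|lra].
have C0 : 0 < 1 / 1000 * (1 / 100) ^+ n :> RR.
  by apply: mulr_gt0; [lra|apply: exprn_gt0; lra].
move: (1 / 1000 * (1 / 100) ^+ n) C0 E E' => C C0 E E'.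
(* The two meeting equations are divided by each other, which removes the scale [C]. *)
have cross : b ^+ m * (1 - V) * X' = b' ^+ m * (1 - V') * X.
  apply: (mulfI (lt0r_neq0 C0)).
  have h1 := congr1 (fun z => z * (b' ^+ m * (1 - V'))) E.
  have h2 := congr1 (fun z => z * (b ^+ m * (1 - V))) E'.
  by move: h1 h2 => /=; lra.
have key : X * (1 - V') * b' <= X' * (1 - V) * b.
  rewrite -(ler_pM2l bm0).
  have : (b ^+ m * b') * ((1 - V') * X) <= (b' ^+ m * b) * ((1 - V') * X).
    by apply: ler_wpM2r => //; nra.
  have : b * (b ^+ m * (1 - V) * X') = b * (b' ^+ m * (1 - V') * X) by rewrite cross.
  by lra.
move: ab ab'; rewrite /admissible => ab ab'.
(* Both [X] and [1 - V'] are at least 1/4. The motion of the cylinders enters with the factor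
   [b <= 1 / 200], which is too small to compensate this term. *)
have f1 : 1 / 16 * (b' - b) <= X * (1 - V') * (b' - b).
  by apply: ler_wpM2r; [lra|nra].
have f2 : X' * (1 - V) - X * (1 - V') <= 2 * (e + 2 * (b' - b)).
  have : (X' - X) * (1 - V) <= e + 2 * (b' - b) by nra.
  have : X * (V' - V) <= e + 2 * (b' - b) by nra.
  by lra.
have : b * (X' * (1 - V) - X * (1 - V')) <= b * (2 * (e + 2 * (b' - b))).
  by apply: ler_wpM2l => //; lra.
have : b * (2 * (e + 2 * (b' - b))) <= 1 / 200 * (2 * (e + 2 * (b' - b))).
  apply: ler_wpM2r; lra.
by lra.
Qed.

(** * Excluding parameters and choosing [b] *)

Lemma cylinders_meet_interval n m u v : (0 < m)%N -> size u = size v ->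
  exists p : RR * RR, [/\ p.1 <= p.2, p.2 - p.1 <= 2 * (1 / 100) ^+ size u &
    forall b, admissible b -> cylinders_meet n m u v b -> p.1 <= b <= p.2].
Proof.
move=> m0 suv; have e0 : 0 <= (1 / 100) ^+ size u :> RR by apply: exprn_ge0; lra.
have [[b0 [ab0 bad0]]|nobad] := pselect (exists b, admissible b /\ cylinders_meet n m u v b).
  exists (b0 - (1 / 100) ^+ size u, b0 + (1 / 100) ^+ size u) => /=.
  split; [lra|lra|move=> b ab badb].
  have [bb|bb] := leP b0 b.
    by have := cylinders_meet_close m0 suv ab0 ab bb bad0 badb; lra.
  by have := cylinders_meet_close m0 suv ab ab0 (ltW bb) badb bad0; lra.
exists (0, 0); split=> /=; [lra|lra|move=> b ab badb].
by case: nobad; exists b.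
Qed.

(** Total length excluded at level [k]: one interval of length at most [2 / 100 ^ k] for each of the
    [36 ^ k] pairs of words. *)
Lemma pow_36_small (e : RR) : 0 < e ->
  exists2 k, (0 < k)%N & (36 ^ k)%:R * (2 * (1 / 100) ^+ k) < e.
Proof.
move=> e0; have [|k k0 kP] := @power_escape (100 / 36) (2 / e); first lra.
move: kP; rewrite ltr_pdivrMr// => kP; exists k => //.
rewrite natrX mulrCA -exprMn.
have z0 : 0 < (36 * (1 / 100)) ^+ k :> RR by apply: exprn_gt0; lra.
have zE : (36 * (1 / 100)) ^+ k * (100 / 36) ^+ k = 1 :> RR.
  by rewrite -exprMn (_ : _ * _ = 1) ?expr1n//; lra.
have := kP; rewrite -(ltr_pM2l z0 2) [ltRHS]mulrA zE !mul1r => h.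
by rewrite mulrC.
Qed.

Lemma cylinders_apart_subinterval n m (x y : RR) : (0 < m)%N ->
  1 / 300 <= x -> x < y -> y <= 1 / 200 -> exists x' y', [/\ x <= x', x' < y', y' <= y &
    forall b, x' <= b <= y' -> exists2 k, (0 < k)%N & forall u v,
      size u = k -> size v = k -> ~ cylinders_meet n m u v b].
Proof.
move=> m0 hx xy hy; have [|k k0 kP] := @pow_36_small (y - x); first lra.
pose pairs := [seq (u, v) | u <- words 6 k, v <- words 6 k].
have step (p : seq 'I_6 * seq 'I_6) : exists q : RR * RR, size p.1 = size p.2 ->
    [/\ q.1 <= q.2, q.2 - q.1 <= 2 * (1 / 100) ^+ size p.1 &
    forall b, admissible b -> cylinders_meet n m p.1 p.2 b -> q.1 <= b <= q.2].
  have [E|E] := eqVneq (size p.1) (size p.2).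
    by have [q h] := cylinders_meet_interval n m0 E; exists q.
  by exists (0, 0) => E'; rewrite E' eqxx in E.
have [F FP] := choice step.
have memP p : p \in pairs -> size p.1 = k /\ size p.2 = k.
  by case/allpairsP => -[u v] [/= + + ->] /=; rewrite !mem_words => /eqP ? /eqP ?.
have [||x' [y' [h1 h2 h3 h4]]] := @subinterval_avoiding x y [seq F p | p <- pairs] xy.
- rewrite all_map; apply/allP => p /memP[E1 E2] /=.
  by have [|? _ _] := FP p; first by rewrite E1 E2.
- rewrite big_map; apply: le_lt_trans kP.
  apply: (@le_trans _ _ (\sum_(p <- pairs) (2 * (1 / 100) ^+ k))).
    rewrite big_seq [leRHS]big_seq; apply: ler_sum => p /memP[E1 E2].
    by have [|_ + _] := FP p; rewrite E1 ?E2.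
  rewrite big_const_seq count_predT iter_addr addr0 size_allpairs !size_words.
  have -> : (6 ^ k * 6 ^ k = 36 ^ k)%N by rewrite -expnMn.
  by rewrite -[leLHS]mulr_natl.
exists x', y'; split=> // b hb; exists k => // u v uk vk badb.
have uvp : (u, v) \in pairs.
  by apply/allpairsP; exists (u, v); rewrite !mem_words uk vk.
have /negP := h4 _ b (map_f F uvp) hb; apply.
have [|_ _ h] := FP (u, v); first by rewrite /= uk vk.
by apply: h => //; rewrite /admissible; lra.
Qed.

(** For large [m] the power [b ^ m] grows by more than a factor 100 across [[x, y]], so some power
    of 100 puts 1 strictly between the two end values. An exact solution [b0] exists by continuity,
    and [e]-closeness persists just to its right. *)
Lemma coincidence_subinterval (x y e : RR) : 1 / 300 <= x -> x < y ->
  y <= 1 / 200 -> 0 < e -> exists x' y', [/\ x <= x', x' < y', y' <= y &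
    forall b, x' <= b <= y' -> exists n m, `|10 * 100 ^+ n * b ^+ m - 1| < e].
Proof.
move=> hx xy hy e0.
have [|m m0 mP] := @power_escape (y / x) 100; first by rewrite ltr_pdivlMr; lra.
have xm0 : 0 < x ^+ m by apply: exprn_gt0; lra.
have ym0 : 0 < y ^+ m by apply: exprn_gt0; lra.
have xym : 100 * x ^+ m < y ^+ m.
  by move: mP; rewrite expr_div_n ltr_pdivlMr.
have ex : exists n, (1 < 10 * 100 ^+ n * y ^+ m).
  have [|n _ nP] := @power_escape 100 (y ^+ m)^-1; first lra.
  exists n; move: nP; rewrite -[ltLHS]mul1r ltr_pdivrMr//; lra.
have nlo : 10 * 100 ^+ (ex_minn ex) * x ^+ m < 1 < 10 * 100 ^+ (ex_minn ex) * y ^+ m.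
  (* For [n = 0] minimality is void and the bound [x ^ m <= 1 / 200] is used; otherwise the
     predecessor of the least index fails at [y]. *)
  case: ex_minnP => -[|n] h nmin; rewrite h andbT.
    have : x ^+ m <= 1 / 200.
      case: (m) m0 => // k _; rewrite exprS.
      have : x ^+ k <= 1 by apply: exprn_ile1; lra.
      have : 0 <= x ^+ k by apply: exprn_ge0; lra.
      nra.
    by rewrite expr0; lra.
  have : 10 * 100 ^+ n * y ^+ m <= 1.
    by rewrite leNgt; apply/negP => /nmin; rewrite ltnn.
  rewrite exprS => h'.
  have p0 : 0 < 10 * 100 ^+ n :> RR by apply: mulr_gt0; [lra|apply: exprn_gt0; lra].
  by have := ltr_pM2l p0 (100 * x ^+ m) (y ^+ m); rewrite xym; lra.
move: (ex_minn ex) nlo => n /andP[nx ny].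
pose f b : RR := 10 * 100 ^+ n * b ^+ m.
have fc : continuous f.
  by move=> z; exact: (cvgM (cvg_cst _) (@exprn_continuous _ m z)).
have [b0 b0xy fb0] : exists2 b0, b0 \in `[x, y] & f b0 = 1.
  apply: IVT; [exact: ltW|exact: continuous_subspaceT|].
  by rewrite ge_min le_max /f (ltW nx) (ltW ny) /= orbT.
have [x0 y0] : x < b0 /\ b0 < y.
  move: b0xy; rewrite in_itv /= !le_eqVlt => /andP[/orP[/eqP h|h1] /orP[/eqP h'|h2]].
  - by rewrite -h' -h ltxx in xy.
  - by move: fb0; rewrite -h /f; lra.
  - by move: fb0; rewrite h' /f; lra.
  - by [].
have [d /= d0 dP] : exists2 d : RR, 0 < d & forall z, `|b0 - z| < d -> `|f z - 1| < e.
  have [d /= d0 dP] := fc b0 (ball (f b0) e) (nbhsx_ballx _ _ e0).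
  by exists d => // z hz; rewrite distrC -fb0; exact: dP.
exists b0, (Num.min y (b0 + d / 2)); split; first exact: ltW.
- by rewrite lt_min y0; lra.
- by rewrite ge_min lexx.
move=> b /andP[b1]; rewrite le_min => /andP[b2 b3].
by exists n, m; apply: dP; rewrite ltr_norml; lra.
Qed.

(** The index type joins the two families: pairs [(n, m)] for separation, and [j] for coincidence up
    to [1 / j.+1]. Exponent [m = 0], where [b ^ m] does not vary, is left out here; [ifs_touch]
    excludes it by size. *)
Lemma exists_parameter : exists2 b, admissible b &
  (forall n m, (0 < m)%N -> exists2 k, (0 < k)%N & forall u v,
    size u = k -> size v = k -> ~ cylinders_meet n m u v b) /\
  (forall e : RR, 0 < e -> exists n m, `|10 * 100 ^+ n * b ^+ m - 1| < e).
Proof.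
pose P (i : nat * nat + nat) (b : RR) : Prop := match i with
  | inl (n, m) => (0 < m)%N -> exists2 k, (0 < k)%N & forall u v,
      size u = k -> size v = k -> ~ cylinders_meet n m u v b
  | inr j => exists n m, `|10 * 100 ^+ n * b ^+ m - 1| < j.+1%:R^-1
  end.
have [||b ab bP] := @nested_intervals_generic _ P (1 / 300) (1 / 200); first lra.
  move=> [[n [|m]]|j] u v hu uv hv.
  - by exists u, v.
  - have [u' [v' [? ? ? h]]] := @cylinders_apart_subinterval n m.+1 u v isT hu uv hv.
    by exists u', v'; split=> // z hz _; exact: h.
  - apply: coincidence_subinterval => //; by rewrite invr_gt0.
exists b => //; split=> [n m|e e0]; first exact: (bP (inl (n, m))).
have [N] : exists N : nat, e^-1 < N%:R.
  by eexists; apply: archi_boundP; rewrite invr_ge0 ltW.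
move=> eN; have [n [m h]] := bP (inr N); exists n, m; apply: lt_le_trans h _.
rewrite -[leRHS]invrK lef_pV2 ?posrE ?invr_gt0//.
by rewrite -natr1; lra.
Qed.

(** * Exponents between 0 and 1, and the similarity dimension *)

(** Cost at most 1 forces lengths at most 1, and there the power with exponent [s <= 1] dominates
    the length. *)
Lemma totally_disconnected_coverable_powR (s : RR) (A : set RR) : 0 < s <= 1 ->
  (forall c : RR, 0 < c -> coverable s A c) -> totally_disconnected A.
Proof.
move=> /andP[s0 s1] As; apply: totally_disconnected_coverable => c c0.
have c10 : 0 < Num.min c 1 by rewrite lt_min c0; lra.
have [l lA] := As _ c10; rewrite le_min => /andP[lc l1].
exists l => //; apply: le_trans lc.
rewrite /interval_cost big_seq [leRHS]big_seq; apply: ler_sum => p pl.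
have p0 : 0 <= p.2 - p.1 by rewrite subr_ge0; case: lA => /allP /(_ _ pl).
rewrite powRr1//; move: p0; rewrite le_eqVlt => /orP[/eqP <-|p0].
  exact: powR_ge0.
apply: ger1_powR => //; rewrite p0 /= leNgt; apply/negP => p1.
have : 1 `^ s < (p.2 - p.1) `^ s by apply: gt0_ltr_powR; rewrite ?nnegrE//; lra.
have := powR_le_interval_cost s pl; rewrite powR1; lra.
Qed.

Lemma powR_exp_continuous (R : realType) (a : R) : 0 < a ->
  continuous (fun x : R => a `^ x).
Proof.
move=> a0; rewrite (_ : (fun x : R => a `^ x) = expR \o *%R^~ (ln a)).
  move=> x; apply: continuous_comp; first exact: mulrr_continuous.
  exact: continuous_expR.
by apply/funext => x; rewrite /powR gt_eqF.
Qed.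

Lemma ltr_powR_exp (a s t : RR) : 0 < a < 1 -> t < s -> a `^ s < a `^ t.
Proof.
move=> /andP[a0 a1] ts; rewrite /powR gt_eqF// ltr_expR ltr_nM2r//.
by apply: ln_lt0; rewrite a0.
Qed.

Lemma similarity_dimension_exists (R : realType) m (r : 'I_m -> R) :
  (forall i, 0 < r i < 1) -> 1 < m%:R :> R -> \sum_i r i < 1 ->
  exists2 s : R, 0 < s <= 1 & \sum_i r i `^ s = 1.
Proof.
move=> r01 m1 r1.
pose f (x : R) : R := \sum_i r i `^ x.
have f0 : f 0 = m%:R.
  rewrite /f (eq_bigr (fun=> 1)) => [|i _]; last by rewrite powRr0.
  by rewrite sumr_const card_ord.
have f1 : f 1 = \sum_i r i.
  by apply: eq_bigr => i _; rewrite powRr1//; case/andP: (r01 i) => /ltW.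
have fc : continuous f.
  apply: continuous_big => [|i _]; first exact: add_continuous.
  by apply: powR_exp_continuous; case/andP: (r01 i).
have [s sin fs] : exists2 s, s \in `[0, 1] & f s = 1.
  apply: IVT; [lra|exact: continuous_subspaceT|].
  by rewrite f0 f1 ge_min le_max (ltW m1) (ltW r1) orbT.
exists s => //; move: sin; rewrite in_itv /= le_eqVlt => /andP[/orP[/eqP s0|->]//].
by move: fs; rewrite -s0 f0; lra.
Qed.

(** * The attractor of the family *)

Section Attractor.
Variables (b : RR) (ab : admissible b).

Let K := attractor_in (ifs b) `[0, 1].

Lemma ifs_unit_sub i : ifs b i @` `[0, 1] `<=` `[0, 1].
Proof.
move=> _ [x /= + <-]; rewrite /= !in_itv /=; exact: ifs_unit.
Qed.

Lemma ifs_attractorE : K = \bigcup_(i in [set: 'I_6]) (ifs b i @` K).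
Proof. exact/attractor_in_fix/ifs_unit_sub. Qed.

Lemma ifs_attractor_sub i : ifs b i @` K `<=` K.
Proof. by move=> _ [x Kx <-]; rewrite ifs_attractorE; exists i => //; exists x. Qed.

Lemma ifs_attractor_pieceP z : K z -> exists i, exists2 y, K y & ifs b i y = z.
Proof. by rewrite {1}ifs_attractorE => -[i _ [y Ky <-]]; exists i, y. Qed.

Lemma ifs_attractor_unit x : K x -> 0 <= x <= 1.
Proof. by move=> /attractor_in_sub; rewrite /= in_itv. Qed.

Lemma ifs_continuous i : continuous (ifs b i).
Proof.
apply: (similarity_continuous _ (ifs_similarity i ab)).
by case/andP: (ifs_ratio_bounds i ab).
Qed.

Lemma ifs_attractor_compact : compact K.
Proof.
apply: attractor_in_compact; first exact: ifs_unit_sub.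
- exact: ifs_continuous.
- exact: segment_compact.
Qed.

Lemma ifs_attractor0 : K 0.
Proof.
apply: (@attractor_in_max _ _ _ [set 0]) => // _ ->.
  by rewrite /= in_itv /=; lra.
exists ord0 => //; exists 0 => //.
by rewrite /ifs /ifs_offset /ifs_slope /= mulr0 addr0.
Qed.

Lemma ifs_attractor1 : K 1.
Proof.
apply: (@attractor_in_max _ _ _ [set 1]) => // _ ->.
  by rewrite /= in_itv /=; lra.
exists ord_max => //; exists 1 => //.
by rewrite /ifs /ifs_offset /ifs_slope /= mulr1 subrK.
Qed.

End Attractor.

(** * Contacts between pieces *)

Section Pieces.
Variables (b : RR) (ab : admissible b).

Let K := attractor_in (ifs b) `[0, 1].

Lemma ifs_eq0 i x : 0 <= x <= 1 -> ifs b i x = 0 -> i = ord0 /\ x = 0.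
Proof.
move: ab; rewrite /admissible /ifs /ifs_offset /ifs_slope => ab' x01.
case: i => [[|[|[|[|[|[|//]]]]]] ilt] /= E; try (exfalso; nra).
by split; [exact: val_inj|lra].
Qed.

Lemma ifs_eq1 i x : 0 <= x <= 1 -> ifs b i x = 1 -> i = ord_max /\ x = 1.
Proof.
move: ab; rewrite /admissible /ifs /ifs_offset /ifs_slope => ab' x01.
case: i => [[|[|[|[|[|[|//]]]]]] ilt] /= E; try (exfalso; nra).
by split; [exact: val_inj|nra].
Qed.

Lemma ifs_word_eq0 w x : 0 <= x <= 1 -> word_map (ifs b) w x = 0 ->
  all (pred1 ord0) w /\ x = 0.
Proof.
move=> x01; elim: w => [|i w IH] //= /(ifs_eq0 (ifs_word_unit w ab x01)).
by move=> [-> /IH[-> ->]]; rewrite eqxx.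
Qed.

Lemma ifs_word_eq1 w x : 0 <= x <= 1 -> word_map (ifs b) w x = 1 ->
  all (pred1 ord_max) w /\ x = 1.
Proof.
move=> x01; elim: w => [|i w IH] //= /(ifs_eq1 (ifs_word_unit w ab x01)).
by move=> [-> /IH[-> ->]]; rewrite eqxx.
Qed.

(** The images of [[0, 1]] are disjoint except for the third and fourth, which both start at 1/2 and
    extend to the right; equality there reads [x / 1000 = (1 - y) / 100]. *)
Lemma ifs_piece_overlap (i j : 'I_6) x y : 0 <= x <= 1 -> 0 <= y <= 1 ->
  (i < j)%N -> ifs b i x = ifs b j y ->
  [/\ i = 2 :> nat, j = 3 :> nat & x = 10 * (1 - y)].
Proof.
move: ab; rewrite /admissible /ifs /ifs_offset /ifs_slope => ab' x01 y01.
case: i => [[|[|[|[|[|[|//]]]]]] ilt]; case: j => [[|[|[|[|[|[|//]]]]]] jlt] //= _ E;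
  try (exfalso; nra).
by split=> //; lra.
Qed.

Lemma ifs_eq_half i x : 0 <= x <= 1 -> ifs b i x = 1 / 2 -> x = 0 \/ x = 1.
Proof.
move: ab; rewrite /admissible /ifs /ifs_offset /ifs_slope => ab' x01.
case: i => [[|[|[|[|[|[|//]]]]]] ilt] /= E; try (exfalso; nra).
  by left; lra.
by right; lra.
Qed.

Lemma ifs_attractor_word z k : K z ->
  exists2 w, size w = k & exists2 x, K x & z = word_map (ifs b) w x.
Proof.
elim: k z => [|k IH] z Kz; first by exists [::] => //; exists z.
have [i [y Ky <-]] := ifs_attractor_pieceP ab Kz.
have [w wk [x Kx ->]] := IH y Ky.
by exists (i :: w); [rewrite /= wk|exists x].
Qed.

Lemma ifs_expand0 x : K x -> x != 0 -> exists n i y,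
  [/\ K y, 1 / 4 <= ifs b i y & x = (1 / 100) ^+ n * ifs b i y].
Proof.
move=> Kx x0; apply: contrapT => nex.
have chain n : exists2 z, K z & x = (1 / 100) ^+ n * z.
  elim: n => [|n [z Kz xz]]; first by exists x; rewrite // expr0 mul1r.
  have [i [y Ky yz]] := ifs_attractor_pieceP ab Kz.
  have y01 := ifs_attractor_unit Ky.
  have [i0|i0] := eqVneq i ord0.
    exists y => //; rewrite xz -yz i0 exprSr /ifs /ifs_offset /ifs_slope /=; lra.
  case: nex; exists n, i, y; split=> //; last by rewrite yz.
  move: ab i0; rewrite /admissible /ifs /ifs_offset /ifs_slope => ab'.
  by case: i {yz} => [[|[|[|[|[|[|//]]]]]] ilt] //= _; nra.
have x01 := ifs_attractor_unit Kx.
have xpos : 0 < x by rewrite lt_neqAle eq_sym x0; lra.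
have [|n _ nP] := @power_escape 100 x^-1; first lra.
have [z Kz xz] := chain n; have z01 := ifs_attractor_unit Kz.
move: nP; rewrite -[ltLHS]mul1r ltr_pdivrMr// xz mulrA -exprMn.
have -> : 100 * (1 / 100) = 1 :> RR by lra.
by rewrite expr1n; lra.
Qed.

Lemma ifs_expand1 x : K x -> x != 1 -> exists n i y,
  [/\ K y, ifs b i y <= 3 / 4 & 1 - x = b ^+ n * (1 - ifs b i y)].
Proof.
move=> Kx x1; apply: contrapT => nex.
have chain n : exists2 z, K z & 1 - x = b ^+ n * (1 - z).
  elim: n => [|n [z Kz xz]]; first by exists x; rewrite // expr0 mul1r.
  have [i [y Ky yz]] := ifs_attractor_pieceP ab Kz.
  have y01 := ifs_attractor_unit Ky.
  have [i0|i0] := eqVneq i ord_max.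
    exists y => //; rewrite xz -yz i0 exprSr /ifs /ifs_offset /ifs_slope /=; lra.
  case: nex; exists n, i, y; split=> //; last by rewrite yz.
  move: ab i0; rewrite /admissible /ifs /ifs_offset /ifs_slope => ab'.
  by case: i {yz} => [[|[|[|[|[|[|//]]]]]] ilt] //= _; nra.
have x01 := ifs_attractor_unit Kx.
have xpos : 0 < 1 - x by rewrite subr_gt0 lt_neqAle x1; lra.
have b0 : 0 < b by move: ab; rewrite /admissible; lra.
have [|n _ nP] := @power_escape b^-1 (1 - x)^-1.
  rewrite -[b^-1]mul1r ltr_pdivlMr//; move: ab; rewrite /admissible; lra.
have [z Kz xz] := chain n; have z01 := ifs_attractor_unit Kz.
move: nP; rewrite -[ltLHS]mul1r ltr_pdivrMr// xz mulrA -exprMn mulVf ?gt_eqF//.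
by rewrite expr1n; lra.
Qed.

Hypothesis separated : forall n m, (0 < m)%N -> exists2 k, (0 < k)%N &
  forall u v, size u = k -> size v = k -> ~ cylinders_meet n m u v b.

(** Expanding [x] at 0 and [y] at 1 turns the contact equation into the one of [cylinders_meet]. *)
Lemma ifs_touch x y : K x -> K y -> x = 10 * (1 - y) -> x = 0 /\ y = 1.
Proof.
move=> Kx Ky xy; have [x0|x0] := eqVneq x 0; first by split=> //; lra.
exfalso; have [y1|y1] := eqVneq y 1.
  by move: x0; rewrite xy y1 subrr mulr0 eqxx.
have [n [i [x1 [Kx1 X4 xE]]]] := ifs_expand0 Kx x0.
have [m [j [y2 [Ky2 V4 yE]]]] := ifs_expand1 Ky y1.
have E : 1 / 1000 * (1 / 100) ^+ n * ifs b i x1 =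
    1 / 100 * b ^+ m * (1 - ifs b j y2).
  by move: xy; rewrite xE yE; lra.
(* If [m = 0] then [1 - y >= 1 / 4], so [x >= 5 / 2], which is outside [[0, 1]]. *)
have [m0|m0] := posnP m.
  have := ifs_attractor_unit Kx; move: xy; rewrite yE m0 expr0; lra.
(* The length is positive, which leaves room for the first letters [i] and [j] given by the
   expansions. *)
have [[//|k] _ kP] := separated n m0.
have [u uk [x3 Kx3 x3E]] := ifs_attractor_word k Kx1.
have [v vk [y3 Ky3 y3E]] := ifs_attractor_word k Ky2.
apply: (kP (i :: u) (j :: v)); rewrite /= ?uk ?vk//.
exists x3, y3; rewrite /= -x3E -y3E; split=> //.
  exact: ifs_attractor_unit Kx3.
exact: ifs_attractor_unit Ky3.
Qed.

Lemma ifs_piece_inter (i j : 'I_6) z : i != j -> (ifs b i @` K) z ->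
  (ifs b j @` K) z -> z = 1 / 2 /\
  ((i = 2 :> nat /\ j = 3 :> nat) \/ (i = 3 :> nat /\ j = 2 :> nat)).
Proof.
wlog ij : i j / (i < j)%N => [hw ij|ne_ij].
  case: (ltngtP i j) => [h|h|/val_inj h]; first exact: hw.
    move=> iz jz; have [] := hw j i h _ jz iz; first by rewrite eq_sym.
    by move=> -> [] [? ?]; split=> //; [right|left].
  by rewrite h eqxx in ij.
move=> [x Kx <-] [y Ky /esym E].
have [i2 j3 xy] := ifs_piece_overlap (ifs_attractor_unit Kx)
  (ifs_attractor_unit Ky) ij E.
have [x0 y1] := ifs_touch Kx Ky xy; split; last by left.
by rewrite x0 /ifs /ifs_offset i2 /= mulr0 addr0.
Qed.

Lemma ifs_inord k x : (k < 6)%N -> ifs b (inord k) x =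
  nth 0 [:: 0; 1 / 4; 1 / 2; 1 / 2 + 1 / 100; 3 / 4; 1 - b] k +
  nth 0 [:: 1 / 100; 1 / 100; 1 / 1000; - (1 / 100); - (1 / 100); b] k * x.
Proof. by move=> k6; rewrite /ifs /ifs_offset /ifs_slope inordK. Qed.

Lemma ifs_inter23 :
  ifs b (inord 2) @` K `&` ifs b (inord 3) @` K = [set 1 / 2].
Proof.
apply/seteqP; split=> [z [z2 z3]|_ ->].
  by have [] := ifs_piece_inter _ z2 z3; first by rewrite -val_eqE /= !inordK.
split.
  exists 0; first exact: ifs_attractor0.
  by rewrite ifs_inord//= mulr0 addr0.
exists 1; first exact: ifs_attractor1.
by rewrite ifs_inord//=; lra.
Qed.

(** A common prefix cancels by injectivity. At the first differing letters, a common point would be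
    the contact, reached in the third piece from the argument 0; a word ending in [inord 1] never
    takes the value 0. *)
Lemma ifs_words_disjoint u v : size u = size v -> u != v ->
  word_map (ifs b) (rcons u (inord 1)) @` K `&`
  word_map (ifs b) (rcons v (inord 1)) @` K = set0.
Proof.
have no0 w x : K x -> word_map (ifs b) (rcons w (inord 1)) x != 0.
  move=> Kx; apply/eqP => /(ifs_word_eq0 (ifs_attractor_unit Kx))[+ _].
  by rewrite all_rcons /= -val_eqE /= inordK.
have Kw w x : K x -> K (word_map (ifs b) w x).
  move=> Kx; apply: (word_map_sub (ifs_attractor_sub ab)); last by exists x.
elim: u v => [|i u IH] [|j v] //= [uv] neq.
apply/seteqP; split=> // z [[x Kx /= xz] [y Ky /= yz]].
have [ij|ij] := eqVneq i j.
  have uv' : u != v by apply: contra_neq neq => ->; rewrite ij.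
  have : word_map (ifs b) (rcons u (inord 1)) x =
         word_map (ifs b) (rcons v (inord 1)) y.
    have i0 : 0 < ifs_ratio b i by case/andP: (ifs_ratio_bounds i ab).
    by apply: (similarity_inj i0 (ifs_similarity i ab)); rewrite xz [in RHS]ij yz.
  move=> E; rewrite -[False]/(set0 z); have := IH v uv uv'.
  move/seteqP => [+ _] => /(_ (word_map (ifs b) (rcons u (inord 1)) x)).
  by apply; split; [exists x|exists y].
have Kx' := Kw (rcons u (inord 1)) x Kx; have Ky' := Kw (rcons v (inord 1)) y Ky.
have E : ifs b i (word_map (ifs b) (rcons u (inord 1)) x) =
  ifs b j (word_map (ifs b) (rcons v (inord 1)) y) by rewrite xz yz.
have touch := ifs_piece_overlap (ifs_attractor_unit Kx') (ifs_attractor_unit Ky').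
have touch' := ifs_piece_overlap (ifs_attractor_unit Ky') (ifs_attractor_unit Kx').
case: (ltngtP i j) => [h|h|/val_inj h]; last by rewrite h eqxx in ij.
  have [_ _ /(ifs_touch Kx' Ky')[h0 _]] := touch _ _ h E.
  by have := no0 u x Kx; rewrite h0 eqxx.
have [_ _ /(ifs_touch Ky' Kx')[h0 _]] := touch' _ _ h (esym E).
by have := no0 v y Ky; rewrite h0 eqxx.
Qed.

End Pieces.

(** * The address map *)

(** Shows that [xget] does not return its default: nested compact images have a common point. *)
Lemma address_map_mem m (S : 'I_m -> RR -> RR) (K : set RR)
    (alpha : nat -> 'I_m) :
  (forall i, continuous (S i)) -> compact K -> K !=set0 ->
  (forall i, S i @` K `<=` K) -> forall n,
  (word_map S [seq alpha k | k <- iota 0 n] @` K) (address_map S K alpha).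
Proof.
move=> Sc cK K0 SK.
pose f n := word_map S [seq alpha k | k <- iota 0 n] @` K.
have wc w : continuous (word_map S w).
  elim: w => [|i w IH] x; first exact: cvg_id.
  exact: (continuous_comp (IH x) (Sc i _)).
have fdec n k : f (n + k)%N `<=` f n.
  move=> _ [x Kx <-]; rewrite iotaD map_cat; eexists; last first.
    by rewrite word_map_cat.
  by apply: (word_map_sub SK); exists x.
suff /xgetPex h : \bigcap_(n in [set: nat]) f n !=set0.
  by move=> n; apply: (h 0 n).
have := cK; rewrite compact_In0 => /(_ nat setT f); apply.
  exists f => n _.
    apply: compact_closed; first exact: Rhausdorff.
    by apply: continuous_compact => //; exact: continuous_subspaceT.
  by apply/seteqP; split=> [x fx|x []//]; split=> //; exact: (word_map_sub SK) fx.
move=> D _; have [x Kx] := K0; pose N := \max_(k <- D) k.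
exists (word_map S [seq alpha k | k <- iota 0 N] x) => n nD.
have /subnKC nN : (n <= N)%N by apply: (@leq_bigmax_seq _ _ _ id).
by apply: (fdec n (N - n)%N); rewrite nN; exists x.
Qed.

Lemma word_ratio_nseq m (r : 'I_m -> RR) n i :
  word_ratio r (nseq n i) = r i ^+ n.
Proof.
rewrite /word_ratio; elim: n => [|n IH]; first by rewrite big_nil expr0.
by rewrite /= big_cons IH exprS.
Qed.

(** * Post-critical finiteness, failure of the open set condition, dimension *)

Section Coincidences.
Variables (b : RR) (ab : admissible b).
Hypothesis separated : forall n m, (0 < m)%N -> exists2 k, (0 < k)%N &
  forall u v, size u = k -> size v = k -> ~ cylinders_meet n m u v b.
Hypothesis coincide : forall e : RR, 0 < e ->
  exists n m, `|10 * 100 ^+ n * b ^+ m - 1| < e.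

Let K := attractor_in (ifs b) `[0, 1].

(** The only critical point 1/2 has only 0 and 1 as preimages in [[0, 1]]. These are reached only
    from themselves, through constant words, so the two constant addresses are the only
    candidates. *)
Lemma ifs_pcf : post_critically_finite (ifs b) K.
Proof.
apply: (@sub_finite_set _ _ [set (fun=> ord0); (fun=> ord_max)]); last first.
  exact: finite_set2.
move=> alpha [w [w0 [i _ [j /= ji [iz jz]]]]].
have ij : i != j by rewrite eq_sym.
have [zE _] := ifs_piece_inter ab separated ij iz jz.
have K0 : K !=set0 by exists 0; exact: ifs_attractor0.
have amem := address_map_mem alpha (ifs_continuous ab)
  (ifs_attractor_compact ab) K0 (ifs_attractor_sub ab).
have Ka : K (address_map (ifs b) K alpha) by have [x Kx <-] := amem 0%N.
have a01 := ifs_attractor_unit Ka.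
have prefix n : exists2 x, 0 <= x <= 1 & word_map (ifs b)
    [seq alpha k | k <- iota 0 n] x = address_map (ifs b) K alpha.
  by have [x Kx xE] := amem n; exists x => //; exact: ifs_attractor_unit Kx.
have kmem k : alpha k \in [seq alpha k | k <- iota 0 k.+1].
  by apply: map_f; rewrite mem_iota add0n ltnSn.
case: w w0 zE {iz jz} => //= l w _ zE.
have [h|h] := ifs_eq_half ab (ifs_word_unit w ab a01) zE.
  have [_ a0] := ifs_word_eq0 ab a01 h; left; apply/funext => k.
  have [x x01 xE] := prefix k.+1; rewrite a0 in xE.
  by have [/allP /(_ _ (kmem k)) /eqP] := ifs_word_eq0 ab x01 xE.
have [_ a1] := ifs_word_eq1 ab a01 h; right; apply/funext => k.
have [x x01 xE] := prefix k.+1; rewrite a1 in xE.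
by have [/allP /(_ _ (kmem k)) /eqP] := ifs_word_eq1 ab x01 xE.
Qed.

Lemma ifs_word_nseq0 n x :
  word_map (ifs b) (nseq n ord0) x = (1 / 100) ^+ n * x.
Proof.
elim: n => [|n IH] /=; first by rewrite expr0 mul1r.
by rewrite IH /ifs /ifs_offset /ifs_slope /= exprS; lra.
Qed.

Lemma ifs_word_nseq5 n x :
  word_map (ifs b) (nseq n ord_max) x = 1 - b ^+ n * (1 - x).
Proof.
elim: n => [|n IH] /=; first by rewrite expr0 mul1r; lra.
by rewrite IH /ifs /ifs_offset /ifs_slope /= exprS; lra.
Qed.

(** Stated for every real [x], not only on [K], because the set in the open set condition may lie
    anywhere on the line. *)
Lemma ifs_near_coincidence (e : RR) : 0 < e -> exists u v,
  word_ratio (ifs_ratio b) (inord 2 :: u) <=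
    2 * word_ratio (ifs_ratio b) (inord 3 :: v) /\
  forall x, exists2 y, `|y - x| <= e * (`|x| + 25) &
    word_map (ifs b) (inord 3 :: v) x = word_map (ifs b) (inord 2 :: u) y.
Proof.
(* The bound 1/2 gives [q >= 1 / 2], hence the factor 2 between the ratios. *)
move=> e0; have e20 : 0 < Num.min e (1 / 2) by rewrite lt_min e0; lra.
have [n [m]] := coincide e20; rewrite lt_min.
set q := 10 * 100 ^+ n * b ^+ m => /andP[qe q2].
have an : (1 / 100) ^+ n * 100 ^+ n = 1 :> RR.
  by rewrite -exprMn (_ : 1 / 100 * 100 = 1) ?expr1n//; lra.
have an0 : 0 < (1 / 100) ^+ n :> RR by apply: exprn_gt0; lra.
have qE : 1 / 100 * b ^+ m = q * (1 / 1000 * (1 / 100) ^+ n).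
  have -> : q * (1 / 1000 * (1 / 100) ^+ n) =
    1 / 100 * b ^+ m * ((1 / 100) ^+ n * 100 ^+ n) by rewrite /q; lra.
  by rewrite an mulr1.
have rat k : (k < 6)%N -> ifs_ratio b (inord k) =
    nth 0 [:: 1 / 100; 1 / 100; 1 / 1000; 1 / 100; 1 / 100; b] k.
  by move=> k6; rewrite /ifs_ratio inordK.
move: q qE qe q2 => q qE qe q2.
exists (nseq n ord0 ++ [:: inord 1]), (nseq m ord_max ++ [:: inord 4]); split.
  rewrite /word_ratio !big_cons !big_cat !big_seq1 /= !rat//=.
  rewrite -!/(word_ratio _ _) !word_ratio_nseq /ifs_ratio /=.
  have q12 : 0 <= 2 * q - 1 by move: q2; rewrite ltr_norml; lra.
  have := mulr_ge0 q12 (ltW an0); lra.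
(* Solution [y] of [1 / 4 + y / 100 = q * (1 / 4 + x / 100)]; 25 is the quotient of 1/4 by 1/100. *)
move=> x; exists (q * x + 25 * (q - 1)).
  have -> : q * x + 25 * (q - 1) - x = (q - 1) * (x + 25) by ring.
  rewrite normrM; apply: ler_pM => //; first exact: ltW.
  by apply: le_trans (ler_normD _ _) _; rewrite lerD2l ger0_norm; lra.
rewrite /= !word_map_cat ifs_word_nseq0 ifs_word_nseq5 /= !ifs_inord//=.
have := congr1 (fun z => z * (1 / 4 + 1 / 100 * x)) qE; rewrite /=; lra.
Qed.

(** An open set containing [x] also contains the nearby [y] with the same image, so its images under
    the third and fourth maps meet. *)
Lemma ifs_not_OSC : ~ OSC (ifs b).
Proof.
move=> [U [Uo [x Ux] SU disj]].
have [e /= e0 eU] := (nbhs_ballP _ _).1 (open_nbhs_nbhs (conj Uo Ux)).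
have x25 : 0 < `|x| + 25 by have := normr_ge0 x; lra.
have e20 : 0 < e / 2 / (`|x| + 25) by rewrite !divr_gt0.
have [u [v [_ uv]]] := ifs_near_coincidence e20.
have [y + E] := uv x; rewrite divfK ?gt_eqF// => yx.
have Uy : U y.
  by apply: eU; rewrite /ball /= distrC; lra.
have wU w z : U z -> U (word_map (ifs b) w z).
  by move=> Uz; apply: (word_map_sub SU); exists z.
have ne23 : inord 2 != inord 3 :> 'I_6 by rewrite -val_eqE /= !inordK.
suff : (ifs b (inord 2) @` U `&` ifs b (inord 3) @` U)
    (word_map (ifs b) (inord 2 :: u) y) by rewrite disj.
split; first by exists (word_map (ifs b) u y) => //; exact: wU.
by rewrite -E; exists (word_map (ifs b) v x) => //; exact: wU.
Qed.

Lemma ifs_coverable (s : RR) : 0 < s -> \sum_i ifs_ratio b i `^ s = 1 ->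
  forall c : RR, 0 < c -> coverable s K c.
Proof.
move=> s0 sum1.
have r0 i : 0 < ifs_ratio b i by case/andP: (ifs_ratio_bounds i ab).
apply: (@coverable_near_coincidences _ (ifs b) (ifs_ratio b) s K (inord 2)
  (inord 3) r0 _ (ltW s0) sum1 (ifs_attractorE ab)).
- by move=> i; exact: ifs_similarity.
- exists ((1 - 0) `^ s).
  apply: coverable_sub (lexx _) (@coverable_itv s 0 1 ler01).
  exact: attractor_in_sub.
- by rewrite -val_eqE /= !inordK.
(* On [[0, 1]] the factor [|x| + 25] is at most 26. *)
move=> e e0; have e260 : 0 < e / 26 by lra.
have [u [v [ruv uv]]] := ifs_near_coincidence e260; exists u, v; split=> // x Kx.
have [y yx E] := uv x; exists y => //; apply: le_trans yx _.
have x01 := ifs_attractor_unit Kx; rewrite ger0_norm; nra.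
Qed.

Lemma ifs_hausdorff_dim (s : RR) : 0 < s -> \sum_i ifs_ratio b i `^ s = 1 ->
  hausdorff_dim K = s%:E.
Proof.
move=> s0 sum1; have Hs := hausdorff_measure_eq0 s0 (ifs_coverable s0 sum1).
apply/eqP; rewrite eq_le; apply/andP; split.
  by apply: ereal_inf_lbound; exists s => //=; split=> //; exact: ltW.
apply: le_ereal_inf_tmp => _ [t [t0 Ht] <-]; rewrite lee_fin leNgt.
apply/negP => ts; move: Ht.
have r01 i : 0 < ifs_ratio b i < 1 by have := ifs_ratio_bounds i ab; lra.
apply: (@hausdorff_measure_neq0 _ (ifs b) (ifs_ratio b) t K (inord 1)) => //.
- by move=> i; case/andP: (r01 i).
- by move=> i; exact: ifs_similarity.
- rewrite -sum1; apply: ltr_sum => [|i _]; last exact: ltr_powR_exp.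
  by apply/hasP; exists ord0; rewrite ?mem_index_enum.
- exact: ifs_attractor_sub.
- exact: ifs_attractor_compact.
- by exists 0; exact: ifs_attractor0.
- exact: ifs_words_disjoint.
Qed.

Lemma ifs_similarity_dimension :
  exists2 s : RR, 0 < s <= 1 & \sum_i ifs_ratio b i `^ s = 1.
Proof.
apply: similarity_dimension_exists => [i||].
- by have := ifs_ratio_bounds i ab; lra.
- by lra.
- rewrite !big_ord_recl big_ord0 /ifs_ratio /=; move: ab; rewrite /admissible; lra.
Qed.

End Coincidences.

(* Indices are 0-based: S_1..S_6 of the paper are S 0 .. S 5, so the
   paper's S_3, S_4 are S (inord 2), S (inord 3). *)
Theorem theorem1 :
  exists (S : 'I_6 -> RR -> RR) (r : 'I_6 -> RR) (K : set RR),
    (forall i, contraction_similarity (S i) (r i)) /\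
    is_attractor S K /\
    totally_disconnected K /\
    K `<=` `[0, 1] /\ K 0 /\ K 1 /\
    (* 1. no open set condition *)
    ~ OSC S /\
    (* 2. the only nonempty intersection of distinct pieces is K_3 n K_4 *)
    (forall i j : 'I_6, i != j -> S i @` K `&` S j @` K !=set0 ->
        (i = inord 2 /\ j = inord 3) \/ (i = inord 3 /\ j = inord 2)) /\
    S (inord 2) @` K `&` S (inord 3) @` K = [set S (inord 2) 0] /\
    S (inord 2) @` K `&` S (inord 3) @` K = [set S (inord 3) 1] /\
    post_critically_finite S K /\
    (* 3. dim_H K = similarity dimension s, and H^s(K) = 0 *)
    exists s : RR,
      (\sum_(i < 6) r i `^ s = 1) /\
      hausdorff_dim K = s%:E /\
      hausdorff_measure s K = 0%E.
Proof.
have [b ab [separated coincide]] := exists_parameter.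
have [s s01 sum1] := ifs_similarity_dimension ab.
have s0 : 0 < s by case/andP: s01.
have cov := ifs_coverable ab coincide s0 sum1.
exists (ifs b), (ifs_ratio b), (attractor_in (ifs b) `[0, 1]).
split.
  move=> i; split; last exact: ifs_similarity.
  by have := ifs_ratio_bounds i ab; lra.
split.
  split; first by exists 0; exact: ifs_attractor0.
  by split; [exact: ifs_attractor_compact|exact: ifs_attractorE].
split; first exact: totally_disconnected_coverable_powR s01 cov.
split; first exact: attractor_in_sub.
split; first exact: ifs_attractor0.
split; first exact: ifs_attractor1.
split; first exact: ifs_not_OSC.
split.
  move=> i j ij [z [iz jz]].
  have [_ h] := ifs_piece_inter ab separated ij iz jz.
  by case: h => -[hi hj]; [left|right]; split; apply: val_inj; rewrite /= inordK.
split.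
  by rewrite ifs_inter23// ifs_inord//= mulr0 addr0.
split.
  rewrite ifs_inter23// ifs_inord//=; congr [set _]; lra.
split; first exact: ifs_pcf.
exists s; split=> //; split; first exact: ifs_hausdorff_dim.
exact: hausdorff_measure_eq0.
Qed.
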